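(* Let $\lambda\in\mathbb{H}$, $\lambda\neq0$, and let $h(x)=\sum_{n=0}^d x^nc_n$ be a polynomial with right coefficients $c_n\in\mathbb{H}$. For each $n$ let $f_n$ be the slice-regular polynomial $$f_n(x)=-c_n\cdot\left(\sum_{k=0}^n\frac{x^k\lambda^k}{k!}\right)n!\,\lambda^{-n-1}.$$ Then the polynomial $f_*=\sum_{n=0}^d f_n$ satisfies $\mathcal{D}_\lambda f_*=h$. On an axially symmetric domain $\Omega$, the general solution $f\in\mathcal{SR}(\Omega)$ of $\mathcal{D}_\lambda f=h$ is $f=f_*+g\cdot\exp_\lambda(x)$ with $g\in\mathcal{SC}(\Omega)$. If $\Omega=\mathbb{H}$ (a slice domain) and $y\in\mathbb{R}$, the solution $f\in\mathcal{SR}(\mathbb{H})$ of $\mathcal{D}_\lambda f=h$ is uniquely determined by its value at $y$, and takes the form $f=f_*+c\cdot\exp_\lambda(x)$ with $c=(f(y)-f_*(y))\exp_{-\lambda}(y)\in\mathbb{H}$. If $\Omega=\mathbb{H}\setminus\mathbb{R}$ (a product domain), the solution $f\in\mathcal{SR}(\Omega)$ of $\mathcal{D}_\lambda f=h$ is uniquely determined by its values at two points.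
   Context: $\mathbb{H}$ is the skew field of quaternions, $\mathbb{S}=\{J\in\mathbb{H}: J^2=-1\}$. For an open set $D\subseteq\mathbb{C}$ invariant under complex conjugation, put $\Omega_D=\{\alpha+J\beta:\ \alpha+i\beta\in D,\ J\in\mathbb{S}\}\subseteq\mathbb{H}$. An axially symmetric domain is a connected open set $\Omega=\Omega_D$ of this form; it is called a slice domain if $\Omega\cap\mathbb{R}\neq\emptyset$ and a product domain if $\Omega\cap\mathbb{R}=\emptyset$. A stem function on $D$ is a map $F=F_1+\imath F_2:D\to\mathbb{H}\otimes_{\mathbb{R}}\mathbb{C}$ ($F_1,F_2$ $\mathbb{H}$-valued, $\imath$ the central imaginary unit of the factor $\mathbb{C}$) with $F(\overline z)=\overline{F(z)}$, conjugation acting on the factor $\mathbb{C}$. It induces the slice function $f=\mathcal{I}(F):\Omega_D\to\mathbb{H}$, $f(\alpha+J\beta)=F_1(\alpha+i\beta)+JF_2(\alpha+i\beta)$. For $F$ of class $C^1$, the slice derivative is $\frac{\partial f}{\partial x}=\mathcal{I}(\frac{\partial F}{\partial z})$ with $\frac{\partial}{\partial z}=\frac12(\partial_\alpha-\imath\partial_\beta)$. $f$ is slice-regular if $F$ is holomorphic, i.e. $\frac12(\partial_\alpha+\imath\partial_\beta)F=0$; $\mathcal{SR}(\Omega)$ is the set of slice-regular functions on $\Omega$. $\mathcal{SC}(\Omega)$ is the set of slice-constant functions: slice-regular $g$ with $\frac{\partial g}{\partial x}=0$ on $\Omega$. The slice product of $f=\mathcal{I}(F)$, $g=\mathcal{I}(G)$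 is $f\cdot g=\mathcal{I}(FG)$, with $FG$ the pointwise product in $\mathbb{H}\otimes\mathbb{C}$; quaternions are identified with constant slice functions, so $a\cdot\sum_n x^nb_n=\sum_n x^nab_n$ for $a\in\mathbb{H}$. For $\lambda\in\mathbb{H}$, $\exp_\lambda(x)=\sum_{n=0}^{+\infty}\frac{x^n\lambda^n}{n!}$, and $\mathcal{D}_\lambda f=\frac{\partial f}{\partial x}-f\lambda$ (pointwise right multiplication by $\lambda$).
   Formalization: On H\R, uniqueness from values at two points is stated for points a1+J1 b1, a2+J2 b2 with b1, b2 > 0 and J1 ≠ J2 (different half-slices); for two points on the same half-slice the claim is false. *)

(* Defs.v *)
From HB Require Import structures.
From mathcomp Require Import all_boot all_order all_algebra.
From mathcomp Require Import all_classical all_reals all_analysis.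
From mathcomp Require Import ring lra.

Set Implicit Arguments.
Unset Strict Implicit.
Unset Printing Implicit Defensive.

Import Order.TTheory GRing.Theory Num.Theory.
Import numFieldNormedType.Exports.

Local Open Scope classical_set_scope.
Local Open Scope ring_scope.

(** * Quaternions *)

Record quat (R : Type) : Type :=
  Quat { qre : R ; qi : R ; qj : R ; qk : R }.

Section QuatChoice.
Variable R : Type.

Definition quat_to_prod (q : quat R) : R * R * (R * R) :=
  ((qre q, qi q), (qj q, qk q)).

Definition quat_of_prod (t : R * R * (R * R)) : quat R :=
  Quat t.1.1 t.1.2 t.2.1 t.2.2.

Lemma quat_to_prodK : cancel quat_to_prod quat_of_prod.
Proof. by case. Qed.

End QuatChoice.

HB.instance Definition _ (R : choiceType) :=
  Choice.copy (quat R) (can_type (@quat_to_prodK R)).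

Section QuatAlgebra.
Variable R : realType.
Implicit Types p q r : quat R.

Lemma quatP p q :
  [/\ qre p = qre q, qi p = qi q, qj p = qj q & qk p = qk q] -> p = q.
Proof.
by case: p q => [a b c d] [a' b' c' d'] /= [-> -> -> ->].
Qed.

Definition qadd p q : quat R :=
  Quat (qre p + qre q) (qi p + qi q) (qj p + qj q) (qk p + qk q).

Definition qopp q : quat R := Quat (- qre q) (- qi q) (- qj q) (- qk q).

Definition qscale (a : R) q : quat R :=
  Quat (a * qre q) (a * qi q) (a * qj q) (a * qk q).

Definition qmul p q : quat R :=
  let: Quat a b c d := p in let: Quat a' b' c' d' := q in
  Quat (a * a' - b * b' - c * c' - d * d')
       (a * b' + b * a' + c * d' - d * c')
       (a * c' - b * d' + c * a' + d * b')
       (a * d' + b * c' - c * b' + d * a').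

Lemma qaddA : associative qadd.
Proof. by move=> p q r; apply: quatP; split; rewrite /= addrA. Qed.

Lemma qaddC : commutative qadd.
Proof. by move=> p q; apply: quatP; split; rewrite /= addrC. Qed.

Lemma qadd0l : left_id (Quat 0 0 0 0) qadd.
Proof. by move=> p; apply: quatP; split; rewrite /= add0r. Qed.

Lemma qaddNl : left_inverse (Quat 0 0 0 0) qopp qadd.
Proof. by move=> p; apply: quatP; split; rewrite /= addNr. Qed.

HB.instance Definition _ :=
  GRing.isZmodule.Build (quat R) qaddA qaddC qadd0l qaddNl.

Lemma qscaleA (a b : R) q : qscale a (qscale b q) = qscale (a * b) q.
Proof. by apply: quatP; split; rewrite /= mulrA. Qed.

Lemma qscale1 : left_id 1 qscale.
Proof. by move=> q; apply: quatP; split; rewrite /= mul1r. Qed.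

Lemma qscaleDr : right_distributive qscale +%R.
Proof. by move=> a p q; apply: quatP; split; rewrite /= mulrDr. Qed.

Lemma qscaleDl q : {morph qscale^~ q : a b / a + b}.
Proof. by move=> a b; apply: quatP; split; rewrite /= mulrDl. Qed.

HB.instance Definition _ := GRing.Zmodule_isLmodule.Build R (quat R)
  qscaleA qscale1 qscaleDr qscaleDl.

Definition qsqn q : R := qre q ^+ 2 + qi q ^+ 2 + qj q ^+ 2 + qk q ^+ 2.

Lemma qsqn_ge0 q : 0 <= qsqn q.
Proof. by rewrite !addr_ge0 ?sqr_ge0. Qed.

Lemma qsqn_eq0 q : qsqn q = 0 -> q = 0.
Proof.
move=> /eqP; rewrite /qsqn !paddr_eq0 ?addr_ge0 ?sqr_ge0 // !sqrf_eq0.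
move=> /andP[/andP[/andP[/eqP e0 /eqP e1] /eqP e2] /eqP e3].
exact: quatP.
Qed.

Definition qnorm q : R := Num.sqrt (qsqn q).

Lemma qnormD p q : qnorm (p + q) <= qnorm p + qnorm q.
Proof.
rewrite /qnorm -[leRHS]ger0_norm ?addr_ge0 ?sqrtr_ge0 //.
rewrite -sqrtr_sqr ler_wsqrtr // sqrrD !sqr_sqrtr ?qsqn_ge0 //.
set t := qre p * qre q + qi p * qi q + qj p * qj q + qk p * qk q.
have tle : t <= Num.sqrt (qsqn p) * Num.sqrt (qsqn q).
  rewrite -sqrtrM ?qsqn_ge0 //; apply: le_trans (ler_norm _) _.
  rewrite -sqrtr_sqr ler_wsqrtr // -subr_ge0.
  rewrite (_ : _ - _ =
    (qre p * qi q - qi p * qre q) ^+ 2 + (qre p * qj q - qj p * qre q) ^+ 2 +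
    (qre p * qk q - qk p * qre q) ^+ 2 + (qi p * qj q - qj p * qi q) ^+ 2 +
    (qi p * qk q - qk p * qi q) ^+ 2 + (qj p * qk q - qk p * qj q) ^+ 2).
    by rewrite !addr_ge0 ?sqr_ge0.
  by rewrite /t /qsqn; ring.
rewrite (_ : qsqn (p + q) = qsqn p + t *+ 2 + qsqn q).
  by rewrite lerD2r lerD2l lerMn2r.
by rewrite /qsqn /t /=; ring.
Qed.

Lemma qnormZ (a : R) q : qnorm (a *: q) = `|a| * qnorm q.
Proof.
rewrite /qnorm (_ : qsqn _ = a ^+ 2 * qsqn q); last by rewrite /qsqn /=; ring.
by rewrite sqrtrM ?sqr_ge0 // sqrtr_sqr.
Qed.

Lemma qnorm_eq0 q : qnorm q = 0 -> q = 0.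
Proof.
move=> /eqP; rewrite sqrtr_eq0 => q0; apply: qsqn_eq0.
by apply/le_anti; rewrite q0 qsqn_ge0.
Qed.

HB.instance Definition _ := Lmodule_isNormed.Build R (quat R)
  qnormD qnormZ qnorm_eq0.

Lemma qmulA : associative qmul.
Proof.
move=> [a b c d] [a' b' c' d'] [a'' b'' c'' d''].
by apply: quatP; split; rewrite /=; ring.
Qed.

Lemma qmul1l : left_id (Quat 1 0 0 0) qmul.
Proof. by move=> [a b c d]; apply: quatP; split; rewrite /=; ring. Qed.

Lemma qmul1r : right_id (Quat 1 0 0 0) qmul.
Proof. by move=> [a b c d]; apply: quatP; split; rewrite /=; ring. Qed.

Lemma qmulDl : left_distributive qmul +%R.
Proof.
move=> [a b c d] [a' b' c' d'] [a'' b'' c'' d''].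
by apply: quatP; split; rewrite /=; ring.
Qed.

Lemma qmulDr : right_distributive qmul +%R.
Proof.
move=> [a b c d] [a' b' c' d'] [a'' b'' c'' d''].
by apply: quatP; split; rewrite /=; ring.
Qed.

Lemma quat_1_neq0 : Quat 1 0 0 0 != 0 :> quat R.
Proof. by apply/eqP => -[/eqP]; rewrite oner_eq0. Qed.

HB.instance Definition _ := GRing.Zmodule_isNzRing.Build (quat R)
  qmulA qmul1l qmul1r qmulDl qmulDr quat_1_neq0.

Lemma qscalerAl (a : R) p q : a *: (p * q) = (a *: p : quat R) * q.
Proof.
case: p q => [a0 b c d] [a' b' c' d'].
by apply: quatP; split; rewrite /=; ring.
Qed.

HB.instance Definition _ :=
  GRing.Lmodule_isLalgebra.Build R (quat R) qscalerAl.

Lemma qscalerAr (a : R) p q : a *: (p * q) = p * (a *: q).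
Proof.
case: p q => [a0 b c d] [a' b' c' d'].
by apply: quatP; split; rewrite /=; ring.
Qed.

HB.instance Definition _ :=
  GRing.Lalgebra_isAlgebra.Build R (quat R) qscalerAr.

Definition qconj q : quat R := Quat (qre q) (- qi q) (- qj q) (- qk q).

Definition qinv q : quat R := (qsqn q)^-1 *: qconj q.

Lemma qmulVq : {in [pred q | q != 0], left_inverse 1 qinv *%R}.
Proof.
move=> q; rewrite inE => q0.
have n0 : qsqn q != 0 by apply: contra_neq q0 => /qsqn_eq0.
rewrite /qinv -scalerAl (_ : qconj q * q = qsqn q *: 1).
  by rewrite scalerA mulVf // scale1r.
case: q {q0 n0} => [a b c d].
by apply: quatP; split; rewrite /qsqn /=; ring.
Qed.

Lemma qmulqV : {in [pred q | q != 0], right_inverse 1 qinv *%R}.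
Proof.
move=> q; rewrite inE => q0.
have n0 : qsqn q != 0 by apply: contra_neq q0 => /qsqn_eq0.
rewrite /qinv -scalerAr (_ : q * qconj q = qsqn q *: 1).
  by rewrite scalerA mulVf // scale1r.
case: q {q0 n0} => [a b c d].
by apply: quatP; split; rewrite /qsqn /=; ring.
Qed.

Lemma qunitP p q : q * p = 1 /\ p * q = 1 -> p \in [pred q | q != 0].
Proof.
move=> [qp _]; rewrite inE; apply/eqP => p0.
by move/eqP: qp; rewrite p0 mulr0 eq_sym oner_eq0.
Qed.

Lemma qinv_out : {in [predC [pred q | q != 0]], qinv =1 id}.
Proof.
move=> q; rewrite !inE negbK => /eqP->.
by apply: quatP; split; rewrite /= ?oppr0 mulr0.
Qed.

HB.instance Definition _ := GRing.NzRing_hasMulInverse.Build (quat R)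
  qmulVq qmulqV qunitP qinv_out.

End QuatAlgebra.

(** * Axially symmetric domains

    The complex plane is R * R, with (alpha, beta) standing for
    alpha + i beta. *)

Section AxiallySymmetric.
Variable R : realType.

Definition cconj (z : R * R) : R * R := (z.1, - z.2).

Definition conj_invariant (D : set (R * R)) : Prop :=
  forall z, D z -> D (cconj z).

Definition imag_units : set (quat R) := [set J | J ^+ 2 = -1].

Definition circularization (D : set (R * R)) : set (quat R) :=
  [set x | exists z J, [/\ D z, imag_units J & x = z.1%:A + z.2 *: J]].

Definition real_axis : set (quat R) := range (fun a : R => a%:A).

Definition axially_symmetric_domain (Omega : set (quat R)) : Prop :=
  (exists D, [/\ open D, conj_invariant D & Omega = circularization D]) /\
  open Omega /\ connected Omega.

Definition slice_domain (Omega : set (quat R)) : Prop :=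
  axially_symmetric_domain Omega /\ Omega `&` real_axis !=set0.

Definition product_domain (Omega : set (quat R)) : Prop :=
  axially_symmetric_domain Omega /\ Omega `&` real_axis = set0.

(* The set D such that Omega = Omega_D; see [shadow_circularization]. *)
Definition shadow (Omega : set (quat R)) : set (R * R) :=
  [set z | exists2 J, imag_units J & Omega (z.1%:A + z.2 *: J)].

Lemma imag_unitsP (J : quat R) : imag_units J <->
  qre J = 0 /\ qi J ^+ 2 + qj J ^+ 2 + qk J ^+ 2 = 1.
Proof.
case: J => [a b c d]; rewrite /imag_units /= expr2.
split=> [[] e1 e2 e3 e4|[-> e]]; last first.
  by apply: quatP; split; rewrite /=; lra.
have : a = 0.
  apply/eqP/negP => /negP a0.
  have b0 : b = 0 by apply: (mulfI a0); lra.
  have c0 : c = 0 by apply: (mulfI a0); lra.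
  have d0 : d = 0 by apply: (mulfI a0); lra.
  by move: e1; rewrite b0 c0 d0; nra.
by move=> a0; subst a; split=> //; lra.
Qed.

Lemma slice_coordE (z : R * R) (J : quat R) : imag_units J ->
  [/\ qre (z.1%:A + z.2 *: J) = z.1, qi (z.1%:A + z.2 *: J) = z.2 * qi J,
      qj (z.1%:A + z.2 *: J) = z.2 * qj J &
      qk (z.1%:A + z.2 *: J) = z.2 * qk J].
Proof.
move=> /imag_unitsP [].
by case: J z => [a b c d] [al be] /= -> _; split; ring.
Qed.

Lemma shadow_circularization (D : set (R * R)) :
  conj_invariant D -> shadow (circularization D) = D.
Proof.
move=> cD; apply/seteqP; split=> [z [J SJ [w [K [Dw SK e]]]]|z Dz].
  have [z1 zi zj zk] := slice_coordE z SJ.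
  have [w1 wi wj wk] := slice_coordE w SK.
  rewrite -e in w1 wi wj wk.
  have e1 : w.1 = z.1 by rewrite -w1.
  have e2 : w.2 ^+ 2 = z.2 ^+ 2.
    have /imag_unitsP [_ nJ] := SJ; have /imag_unitsP [_ nK] := SK.
    rewrite -[LHS]mulr1 -[RHS]mulr1 -{1}nK -nJ !mulrDr -!exprMn.
    by rewrite -wi -wj -wk -zi -zj -zk.
  move/eqP: e2; rewrite eqf_sqr => /orP[] /eqP e2.
    by rewrite [z]surjective_pairing -e1 -e2 -surjective_pairing.
  by have := cD _ Dw; rewrite /cconj e1 e2 opprK -surjective_pairing.
have SI : imag_units (Quat 0 1 0 0).
  by apply/imag_unitsP; split=> /=; ring.
by exists (Quat 0 1 0 0) => //; exists z, (Quat 0 1 0 0).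
Qed.

End AxiallySymmetric.

(** * Stem functions and slice functions

    An element F1 + iota F2 of the tensor product of H and C is the pair
    (F1, F2). *)

Section SliceFunctions.
Variable R : realType.

Definition hc : Type := (quat R * quat R)%type.

Definition hc_conj (w : hc) : hc := (w.1, - w.2).

Definition hc_iota (w : hc) : hc := (- w.2, w.1).

Definition hc_mul (v w : hc) : hc :=
  (v.1 * w.1 - v.2 * w.2, v.1 * w.2 + v.2 * w.1).

Definition stem_function (D : set (R * R)) (F : R * R -> hc) : Prop :=
  forall z, D z -> F (cconj z) = hc_conj (F z).

Definition d_alpha (F : R * R -> hc) : R * R -> hc := 'D_(1, 0) F.
Definition d_beta (F : R * R -> hc) : R * R -> hc := 'D_(0, 1) F.

Definition class_C1 (D : set (R * R)) (F : R * R -> hc) : Prop :=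
  forall z, D z ->
    [/\ derivable F z (1, 0), derivable F z (0, 1),
        {for z, continuous (d_alpha F)} & {for z, continuous (d_beta F)}].

Definition d_z (F : R * R -> hc) (z : R * R) : hc :=
  2^-1 *: (d_alpha F z - hc_iota (d_beta F z)).

Definition d_zbar (F : R * R -> hc) (z : R * R) : hc :=
  2^-1 *: (d_alpha F z + hc_iota (d_beta F z)).

Definition imag_norm (x : quat R) : R :=
  Num.sqrt (qi x ^+ 2 + qj x ^+ 2 + qk x ^+ 2).

Definition imag_dir (x : quat R) : quat R :=
  (imag_norm x)^-1 *: Quat 0 (qi x) (qj x) (qk x).

(* The slice function I(F), through the representation x = alpha + J beta
   with beta >= 0. On the real axis [imag_dir] is 0, which is harmless since
   the second component of a stem function vanishes there;
   see [slice_ofE]. *)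
Definition slice_of (F : R * R -> hc) (x : quat R) : quat R :=
  (F (qre x, imag_norm x)).1 + imag_dir x * (F (qre x, imag_norm x)).2.

Lemma slice_ofE (D : set (R * R)) (F : R * R -> hc) (z : R * R)
    (J : quat R) :
  conj_invariant D -> stem_function D F -> D z -> imag_units J ->
  slice_of F (z.1%:A + z.2 *: J) = (F z).1 + J * (F z).2.
Proof.
move=> cD sF Dz SJ; have [z1 zi zj zk] := slice_coordE z SJ.
have /imag_unitsP [J0 nJ] := SJ.
have nE : imag_norm (z.1%:A + z.2 *: J) = `|z.2|.
  by rewrite /imag_norm zi zj zk !exprMn -!mulrDr nJ mulr1 sqrtr_sqr.
have dE : imag_dir (z.1%:A + z.2 *: J) = (`|z.2|^-1 * z.2) *: J.
  rewrite /imag_dir nE zi zj zk -scalerA; congr (_ *: _).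
  by apply: quatP; split=> //=; rewrite J0 mulr0.
rewrite /slice_of nE dE z1.
have [b0|b0|b0] := ltgtP z.2 0.
- have -> : (z.1, `|z.2|) = cconj z by rewrite /cconj ltr0_norm.
  rewrite sF // /hc_conj /= ltr0_norm // invrN mulNr mulVf ?lt_eqF //.
  by rewrite scaleN1r mulrNN.
- rewrite gtr0_norm // mulVf ?gt_eqF // scale1r.
  by rewrite -surjective_pairing.
- have zE : cconj z = z by rewrite /cconj b0 oppr0 -b0 -surjective_pairing.
  have F20 : (F z).2 = 0.
    have := sF _ Dz; rewrite zE => /(congr1 snd) /= e.
    have : 2%:R *: (F z).2 = 0 by rewrite scaler_nat mulr2n {1}e addNr.
    by move/eqP; rewrite scaler_eq0 pnatr_eq0 /= => /eqP.
  rewrite b0 normr0 mulr0 scale0r mul0r addr0.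
  have -> : (z.1, 0) = z by rewrite -b0 -surjective_pairing.
  by rewrite F20 mulr0 addr0.
Qed.

Definition induces (Omega : set (quat R)) (F : R * R -> hc)
    (f : quat R -> quat R) : Prop :=
  stem_function (shadow Omega) F /\ forall x, Omega x -> f x = slice_of F x.

(* The stem function inducing f on Omega (unique on the shadow of Omega, by
   [induces_unique]); the zero function if f is not a slice function. *)
Definition stem_of (Omega : set (quat R)) (f : quat R -> quat R) :
    R * R -> hc :=
  xget (cst 0 : R * R -> hc) [set F | induces Omega F f].

Lemma induces_unique (D : set (R * R)) (F G : R * R -> hc)
    (f : quat R -> quat R) :
  conj_invariant D -> induces (circularization D) F f ->
  induces (circularization D) G f -> forall z, D z -> F z = G z.
Proof.
move=> cD; rewrite /induces shadow_circularization // => -[sF eF] [sG eG] z Dz.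
have SI : imag_units (Quat 0 1 0 0 : quat R).
  by apply/imag_unitsP; split=> /=; ring.
set I : quat R := Quat 0 1 0 0 in SI *.
have SNI : imag_units (- I) by rewrite /imag_units /= sqrrN.
have E J : imag_units J -> (F z).1 + J * (F z).2 = (G z).1 + J * (G z).2.
  move=> SJ; have zJ : circularization D (z.1%:A + z.2 *: J) by exists z, J.
  by rewrite -(slice_ofE cD sF Dz SJ) -(slice_ofE cD sG Dz SJ) -eF // eG.
have e1 := E _ SI; have e2 := E _ SNI.
have a1 : (F z).1 = (G z).1.
  have : 2%:R *: (F z).1 = 2%:R *: (G z).1.
    have := congr2 +%R e1 e2; rewrite !mulNr !addrA.
    rewrite (addrAC (F z).1) (addrAC (G z).1) !addrK.
    by rewrite !scaler_nat !mulr2n.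
  by apply: scalerI; rewrite pnatr_eq0.
have a2 : (F z).2 = (G z).2.
  have I0 : I \is a GRing.unit.
    by apply/unitrP; exists (- I); rewrite mulrN mulNr -expr2 SI opprK.
  by apply: (mulrI I0); move: e1; rewrite a1 => /addrI.
by rewrite [LHS]surjective_pairing a1 a2 -surjective_pairing.
Qed.

Definition slice_regular (Omega : set (quat R)) (f : quat R -> quat R) :
    Prop :=
  exists F, [/\ induces Omega F f, class_C1 (shadow Omega) F &
    forall z, shadow Omega z -> d_zbar F z = 0].

Definition slice_deriv (Omega : set (quat R)) (f : quat R -> quat R) :
    quat R -> quat R :=
  slice_of (d_z (stem_of Omega f)).

Definition slice_constant (Omega : set (quat R)) (g : quat R -> quat R) :
    Prop :=
  slice_regular Omega g /\ forall x, Omega x -> slice_deriv Omega g x = 0.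

Definition slice_prod (Omega : set (quat R)) (f g : quat R -> quat R) :
    quat R -> quat R :=
  slice_of (fun z => hc_mul (stem_of Omega f z) (stem_of Omega g z)).

Definition exp_slice (lam x : quat R) : quat R :=
  limn (series (fun n => n`!%:R^-1 *: (x ^+ n * lam ^+ n))).

Definition D_op (Omega : set (quat R)) (lam : quat R)
    (f : quat R -> quat R) (x : quat R) : quat R :=
  slice_deriv Omega f x - f x * lam.

Definition right_poly (d : nat) (c : 'I_d.+1 -> quat R) (x : quat R) :
    quat R :=
  \sum_(n < d.+1) x ^+ n * c n.

Definition exp_trunc (lam : quat R) (n : nat) (x : quat R) : quat R :=
  \sum_(k < n.+1) k`!%:R^-1 *: (x ^+ k * lam ^+ k).

(* Left multiplication by the constant is the slice product; right
   multiplication by a constant is pointwise. *)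
Definition f_part (lam a : quat R) (n : nat) (x : quat R) : quat R :=
  - slice_prod setT (cst a) (exp_trunc lam n) x * (n`!%:R * lam ^- n.+1).

Definition f_star (lam : quat R) (d : nat) (c : 'I_d.+1 -> quat R)
    (x : quat R) : quat R :=
  \sum_(n < d.+1) f_part lam (c n) n x.

Definition D_solution (Omega : set (quat R)) (lam : quat R)
    (h f : quat R -> quat R) : Prop :=
  slice_regular Omega f /\ forall x, Omega x -> D_op Omega lam f x = h x.

End SliceFunctions.

(* Main.v *)
(** Stem functions are treated as maps into the biquaternions H (x) C, with
    iota the central element (0, 1). A stem function F is holomorphic exactly
    when d_alpha F = F' and d_beta F = iota F' for a continuous F', and
    D_lambda f = h then reads F' = F lambda + H. The stem of exp_lambda is
    E = exp(z lambda), with E' = E lambda = lambda E and inverse the stem of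
    exp_{-lambda}. Hence, if K is the difference of two solutions, then
    (K E^{-1})' = 0, while every G with G' = 0 gives a solution G E of the
    homogeneous equation. A stem with zero derivative is constant on products
    of intervals, hence on the plane, where its second component vanishes, and
    on the upper half-plane. There it is a pair (a, b), and the vanishing of
    G E at a point of C_J forces a + J b = 0, because E E^c is invertible for
    the conjugate E^c of E; two different J give a = b = 0. *)

From HB Require Import structures.
Require Import Defs.
From mathcomp Require Import all_boot all_order all_algebra.
From mathcomp Require Import all_classical all_reals all_analysis.
From mathcomp Require Import ring lra.

Set Implicit Arguments.
Unset Strict Implicit.
Unset Printing Implicit Defensive.

Import Order.TTheory GRing.Theory Num.Theory.
Import numFieldNormedType.Exports.

Local Open Scope classical_set_scope.
Local Open Scope ring_scope.

(** * The algebra of biquaternions *)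

Section Biquaternions.
Variable R : realType.
Implicit Types (p q : quat R) (u v w : hc R).

(* The pair type also carries the componentwise product; the instances are
   declared on the constant [hc] so that [*] denotes [hc_mul] there. *)
HB.instance Definition _ := NormedModule.copy (hc R) (quat R * quat R)%type.

Lemma hc_mulA : associative (@hc_mul R).
Proof.
move=> [u1 u2] [v1 v2] [w1 w2]; rewrite /hc_mul /=; congr (_, _).
  rewrite !mulrBr !mulrBl !mulrDr !mulrDl !mulrA !opprD !addrA.
  by do 2 rewrite (addrAC _ (- (u2 * v2 * w1))).
rewrite !mulrBl !mulrBr !mulrDr !mulrDl !mulrA !addrA.
by do 2 rewrite (addrAC _ (- (u2 * v2 * w2))).
Qed.

Lemma hc_mul1l : left_id (1, 0) (@hc_mul R).
Proof. by move=> [w1 w2]; rewrite /hc_mul /= !mul1r !mul0r subr0 addr0. Qed.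

Lemma hc_mul1r : right_id (1, 0) (@hc_mul R).
Proof. by move=> [w1 w2]; rewrite /hc_mul /= !mulr1 !mulr0 subr0 add0r. Qed.

Lemma hc_mulDl : left_distributive (@hc_mul R) +%R.
Proof.
move=> [u1 u2] [v1 v2] [w1 w2]; rewrite /hc_mul /= !mulrDl opprD.
by congr (_, _); rewrite addrACA.
Qed.

Lemma hc_mulDr : right_distributive (@hc_mul R) +%R.
Proof.
move=> [u1 u2] [v1 v2] [w1 w2]; rewrite /hc_mul /= !mulrDr opprD.
by congr (_, _); rewrite addrACA.
Qed.

Lemma hc_1_neq0 : (1, 0) != 0 :> hc R.
Proof. by apply/eqP => -[/eqP]; rewrite oner_eq0. Qed.

HB.instance Definition _ := GRing.Zmodule_isNzRing.Build (hc R)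
  hc_mulA hc_mul1l hc_mul1r hc_mulDl hc_mulDr hc_1_neq0.

Lemma hc_scalerAl (a : R) v w : a *: (v * w) = (a *: v : hc R) * w.
Proof.
case: v w => [v1 v2] [w1 w2]; rewrite /GRing.mul/= /hc_mul /=.
by congr (_, _); rewrite /= ?scalerBr ?scalerDr !scalerAl.
Qed.

HB.instance Definition _ := GRing.Lmodule_isLalgebra.Build R (hc R) hc_scalerAl.

Lemma hc_scalerAr (a : R) v w : a *: (v * w) = v * (a *: w).
Proof.
case: v w => [v1 v2] [w1 w2]; rewrite /GRing.mul/= /hc_mul /=.
by congr (_, _); rewrite /= ?scalerBr ?scalerDr !scalerAr.
Qed.

HB.instance Definition _ := GRing.Lalgebra_isAlgebra.Build R (hc R) hc_scalerAr.

Lemma hc_mulE v w : hc_mul v w = v * w. Proof. by []. Qed.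

(** * Norm estimates and continuity of the product *)

Lemma qnormM p q : `|p * q| = `|p| * `|q|.
Proof.
rewrite /Num.norm /= /qnorm -sqrtrM ?qsqn_ge0 //; congr Num.sqrt.
by case: p q => [a b c e] [a' b' c' e']; rewrite /qsqn /=; ring.
Qed.

Lemma hc_normE w : `|w| = Num.max `|w.1| `|w.2|.
Proof. by []. Qed.

(** The norm is the maximum of the two quaternion norms and is not submultiplicative: each component
    of a product is a sum of two products, hence the factor 2. *)
Lemma hc_normM v w : `|v * w| <= 2 * (`|v| * `|w|).
Proof.
have le1 u : `|u.1| <= `|u| by rewrite hc_normE le_max lexx.
have le2 u : `|u.2| <= `|u| by rewrite hc_normE le_max lexx orbT.
have b p q : `|p| <= `|v| -> `|q| <= `|w| -> `|p * q| <= `|v| * `|w|.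
  by move=> ? ?; rewrite qnormM ler_pM.
rewrite mulr_natl mulr2n hc_normE ge_max; apply/andP; split.
  by apply: le_trans (ler_normB _ _) _; apply: lerD; apply: b.
by apply: le_trans (ler_normD _ _) _; apply: lerD; apply: b.
Qed.

(** The error splits as f g - v w = f (g - w) + (f - v) w, and [hc_normM] squeezes both terms to
    0. *)
Lemma hc_cvgM {T : Type} {F : set_system T} {FF : Filter F}
    (f g : T -> hc R) v w :
  f @ F --> v -> g @ F --> w -> (fun t => f t * g t) @ F --> v * w.
Proof.
move=> fv gw.
have f0 : `|f t - v| @[t --> F] --> (0 : R).
  by rewrite -(normr0 (hc R)) -(subrr v); apply: cvg_norm; apply: cvgB => //; exact: cvg_cst.
have g0 : `|g t - w| @[t --> F] --> (0 : R).
  by rewrite -(normr0 (hc R)) -(subrr w); apply: cvg_norm; apply: cvgB => //; exact: cvg_cst.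
have fn : `|f t| @[t --> F] --> `|v| by apply: cvg_norm.
apply/subr_cvg0/norm_cvg0P.
have B t : 0 <= `|f t * g t - v * w| <=
    2 * (`|f t| * `|g t - w|) + 2 * (`|f t - v| * `|w|).
  rewrite normr_ge0 /= (_ : f t * g t - v * w = f t * (g t - w) + (f t - v) * w).
    by apply: le_trans (ler_normD _ _) _; apply: lerD; apply: hc_normM.
  by rewrite mulrBr mulrBl addrA subrK.
apply: squeeze_cvgr (cvg_cst (0 : R)) _; first by apply: nearW; exact: B.
rewrite (_ : 0 = 2 * (`|v| * 0) + 2 * (0 * `|w|)); last by rewrite mul0r !mulr0 addr0.
apply: cvgD; apply: cvgM; (try exact: cvg_cst); apply: cvgM => //; exact: cvg_cst.
Qed.

End Biquaternions.

(** * Directional derivatives: linear maps and the noncommutative product rule *)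

Section Derivatives.
Context {R : realType}.

Lemma is_deriveP {V W : normedModType R} (f : V -> W) a v df :
  is_derive a v f df <->
  (fun h : R => h^-1 *: (f (h *: v + a) - f a)) @ 0^' --> df.
Proof.
split=> [[dv <-]|cf]; first exact: dv.
apply: DeriveDef; first by apply/cvg_ex; exists df.
exact: cvg_lim cf.
Qed.

Lemma lin_scale_sub {W W' : lmodType R} (L : W -> W') : linear L ->
  (forall b u, L (b *: u) = b *: L u) * (forall u v, L (u - v) = L u - L v).
Proof.
move=> linL; have L0 : L 0 = 0.
  have := linL 1 0 0; rewrite !scale1r addr0 => /(congr1 (+%R^~ (- L 0))).
  by rewrite subrr addrK.
split=> [b u|u v]; first by have := linL b u 0; rewrite !addr0 L0 addr0.
by rewrite -scaleN1r addrC linL scaleN1r addrC.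
Qed.

(** Continuity along the single direction [v], which is all that the product rule asks for: f(a + h
    v) is h times the difference quotient, plus f(a). *)
Lemma is_derive_cvg {V W : normedModType R} (f : V -> W) a v df :
  is_derive a v f df -> f (h *: v + a) @[h --> 0^'] --> f a.
Proof.
move=> /is_deriveP cf.
have : (fun h : R => h *: (h^-1 *: (f (h *: v + a) - f a)) + f a) @ 0^' --> 0 *: df + f a.
  by apply: cvgD; [apply: cvgZ => //; exact: nbhs_dnbhs|exact: cvg_cst].
rewrite scale0r add0r; apply: cvg_trans; apply: near_eq_cvg.
near=> h; rewrite scalerA mulfV ?scale1r ?subrK //.
by near: h; exact: nbhs_dnbhs_neq.
Unshelve. all: by end_near. Qed.

Lemma lin_cvg {W W' : normedModType R} (L : W -> W') (M : R)
    {T : Type} {F : set_system T} {FF : Filter F} (f : T -> W) w :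
  linear L -> (forall u, `|L u| <= M * `|u|) ->
  f @ F --> w -> L (f t) @[t --> F] --> L w.
Proof.
move=> linL bL fw; apply/subr_cvg0/norm_cvg0P.
have f0 : M * `|f t - w| @[t --> F] --> (0 : R).
  rewrite -(mulr0 M); apply: cvgM; first exact: cvg_cst.
  by rewrite -(normr0 W) -(subrr w); apply: cvg_norm; apply: cvgB => //; exact: cvg_cst.
apply: squeeze_cvgr (cvg_cst (0 : R)) f0; apply: nearW => t.
by rewrite normr_ge0 -(lin_scale_sub linL) bL.
Qed.

Lemma is_derive_lin {V W W' : normedModType R} (L : W -> W') (M : R)
    (f : V -> W) a v df :
  linear L -> (forall u, `|L u| <= M * `|u|) ->
  is_derive a v f df -> is_derive a v (fun x => L (f x)) (L df).
Proof.
move=> linL bL /is_deriveP cf; apply/is_deriveP.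
have : L (h^-1 *: (f (h *: v + a) - f a)) @[h --> 0^'] --> L df.
  exact: lin_cvg linL bL cf.
apply: cvg_trans; apply: near_eq_cvg; near=> h.
by rewrite !(lin_scale_sub linL).
Unshelve. all: by end_near. Qed.

(** The usual splitting of the difference quotient, with the order of the factors kept; the value of
    g at the moved point is handled by [is_derive_cvg]. *)
Lemma is_derive_hcM {V : normedModType R} (f g : V -> hc R) a v df dg :
  is_derive a v f df -> is_derive a v g dg ->
  is_derive a v (fun x => f x * g x) (df * g a + f a * dg).
Proof.
move=> cf cg; have gc := is_derive_cvg cg.
move: cf cg => /is_deriveP cf /is_deriveP cg; apply/is_deriveP.
have : (h^-1 *: (f (h *: v + a) - f a)) * g (h *: v + a) +
    f a * (h^-1 *: (g (h *: v + a) - g a)) @[h --> 0^'] -->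
    df * g a + f a * dg.
  by apply: cvgD; apply: hc_cvgM => //; exact: cvg_cst.
apply: cvg_trans; apply: near_eq_cvg; near=> h.
rewrite -scalerAl -scalerAr -scalerDr; congr (_ *: _).
by rewrite mulrBl mulrBr addrA subrK.
Unshelve. all: by end_near. Qed.

End Derivatives.

(** * Real coordinates on biquaternions, reducing limits and derivatives to real functions *)

Section Coordinates.
Context {R : realType}.
Implicit Types (q : quat R) (w : hc R).

Definition qcoord (k : 'I_4) q : R := [:: qre q; qi q; qj q; qk q]`_k.

Definition qbasis (k : 'I_4) : quat R :=
  Quat (k == 0 :> nat)%:R (k == 1 :> nat)%:R (k == 2 :> nat)%:R (k == 3 :> nat)%:R.

Definition hcoord (k : bool * 'I_4) w : R := qcoord k.2 (if k.1 then w.2 else w.1).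

Definition hbasis (k : bool * 'I_4) : hc R :=
  if k.1 then (0, qbasis k.2) else (qbasis k.2, 0).

Lemma qcoord_sum q : q = \sum_k qcoord k q *: qbasis k.
Proof.
rewrite !big_ord_recl big_ord0 /qcoord /=.
by case: q => a b c d; apply: quatP; split => /=; ring.
Qed.

Lemma hcoord_sum w : w = \sum_k hcoord k w *: hbasis k.
Proof.
rewrite -(pair_bigA _ (fun b k => hcoord (b, k) w *: hbasis (b, k))) /=.
rewrite big_bool /= addrC.
have -> : \sum_k hcoord (true, k) w *: hbasis (true, k) = (0, w.2).
  rewrite [in RHS](qcoord_sum w.2).
  elim/big_rec2: _ => // k y1 y2 _ ->.
  by rewrite /hcoord /hbasis /=; congr (_, _); rewrite /= scaler0 addr0.
have -> : \sum_k hcoord (false, k) w *: hbasis (false, k) = (w.1, 0).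
  rewrite [in RHS](qcoord_sum w.1).
  elim/big_rec2: _ => // k y1 y2 _ ->.
  by rewrite /hcoord /hbasis /=; congr (_, _); rewrite /= scaler0 addr0.
by case: w => a b; congr (_, _); rewrite /= ?addr0 ?add0r.
Qed.

Lemma qcoord_linear k : linear (qcoord k).
Proof. by move=> a p q; rewrite /qcoord; case: k => -[|[|[|[|]]]]. Qed.

Lemma hcoord_linear k : linear (hcoord k).
Proof. by case: k => -[] k a v w; rewrite /hcoord /= -qcoord_linear. Qed.

Lemma le_qcoord k q : `|qcoord k q| <= `|q|.
Proof.
rewrite -sqrtr_sqr; apply: ler_wsqrtr; rewrite /qsqn.
have := sqr_ge0 (qre q); have := sqr_ge0 (qi q).
have := sqr_ge0 (qj q); have := sqr_ge0 (qk q).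
by rewrite /qcoord; case: k => -[|[|[|[|//]]]] /= _; lra.
Qed.

Lemma le_hcoord k w : `|hcoord k w| <= 1 * `|w|.
Proof.
rewrite mul1r hc_normE le_max /hcoord.
by case: (k.1); rewrite le_qcoord ?orbT.
Qed.

Lemma hcoord_inj v w : (forall k, hcoord k v = hcoord k w) -> v = w.
Proof.
move=> e; rewrite (hcoord_sum v) (hcoord_sum w).
by apply: eq_bigr => k _; rewrite e.
Qed.

Lemma hcoord_cvg {T : Type} {F : set_system T} {FF : Filter F} (f : T -> hc R) w :
  (forall k, hcoord k (f t) @[t --> F] --> hcoord k w) -> f @ F --> w.
Proof.
move=> cf; rewrite [X in _ --> X]hcoord_sum.
rewrite (_ : f = fun t => \sum_k hcoord k (f t) *: hbasis k).
  apply: cvg_big; first exact: add_continuous.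
  by move=> k _; apply: cvgZr_tmp.
by apply/funext => t; exact: hcoord_sum.
Qed.

Lemma hcoord_is_derive {V : normedModType R} (f : V -> hc R) a v df :
  (forall k, is_derive a v (fun x => hcoord k (f x)) (hcoord k df)) ->
  is_derive a v f df.
Proof.
move=> cf; apply/is_deriveP/hcoord_cvg => k.
have /is_deriveP := cf k; apply: cvg_trans; apply: near_eq_cvg; near=> h.
by rewrite !(lin_scale_sub (@hcoord_linear k)).
Unshelve. all: by end_near. Qed.

(** The mean value theorem holds for real functions only, so it is applied to each of the eight
    coordinates. *)
Lemma is_derive_zero_eq (f : R -> hc R) (x y : R) : x <= y ->
  (forall t, x <= t <= y -> is_derive t (1 : R) f 0) -> f x = f y.
Proof.
move=> xy df; apply: hcoord_inj => k.
have dk t : x <= t <= y -> is_derive t (1 : R) (fun s => hcoord k (f s)) 0.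
  move=> /df dt.
  have := is_derive_lin (@hcoord_linear k) (@le_hcoord k) dt.
  by rewrite -(scale0r 0) (lin_scale_sub (@hcoord_linear k)) !scale0r.
have := @MVT_segment _ (fun s => hcoord k (f s)) (cst 0) x y xy.
case=> [t|| t _].
- by rewrite in_itv /= => /andP[xt ty]; apply: dk; rewrite !ltW.
- apply: derivable_within_continuous => t; rewrite in_itv /= => /dk dt.
  exact: ex_derive.
- by rewrite mul0r => /eqP; rewrite subr_eq0 => /eqP ->.
Qed.

End Coordinates.

(** * The exponential of biquaternions *)

Section HcExp.
Context {R : realType}.
Implicit Types (v w : hc R).

Definition hcexp_coeff w n : hc R := n`!%:R^-1 *: w ^+ n.

Definition hcexp w : hc R := limn (series (hcexp_coeff w)).

Lemma hc_normX w n : `|w ^+ n| <= (2 * `|w|) ^+ n.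
Proof.
elim: n => [|n ih].
  rewrite !expr0 hc_normE /= normr0 (_ : `|1 : quat R| = 1) ?maxEle ?ler10 //.
  by rewrite /Num.norm /= /qnorm /qsqn /= expr1n !expr0n !addr0 sqrtr1.
rewrite !exprS; apply: le_trans (hc_normM _ _) _.
by rewrite -mulrA ler_wpM2l // ler_wpM2l.
Qed.

(** Coefficients of the real power series in t of the [k]-th coordinate of v exp(t w). The left
    factor [v] is kept general because differentiation replaces it by v w. *)
Let coeff v w k n : R := hcoord k (v * w ^+ n) / n`!%:R.

(** The terms are dominated by 2|v| times those of the real series of exp(2|w||K|), by [hc_normM]
    and [hc_normX]. *)
Let coeff_cvg v w k (K : R) : cvgn (pseries (coeff v w k) K).
Proof.
apply: normed_cvg.
apply: (@series_le_cvg _ _ (fun n => 2 * `|v| * exp_coeff (2 * `|w| * `|K|) n)).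
- by move=> n; exact: normr_ge0.
- by move=> n; rewrite !mulr_ge0 // exp_coeff_ge0 // !mulr_ge0.
- move=> n; rewrite /= /coeff /exp_coeff /= normrM normrX normrM normfV [`|_%:R|]ger0_norm //.
  rewrite exprMn !mulrA -[leRHS]mulrAC; apply: ler_wpM2r; first by rewrite exprn_ge0.
  apply: ler_wpM2r => //.
  apply: le_trans (le_hcoord _ _) _; rewrite mul1r; apply: le_trans (hc_normM _ _) _.
  by rewrite -mulrA ler_wpM2l // ler_wpM2l // hc_normX.
- by apply: is_cvg_seriesZ; exact: is_cvg_series_exp_coeff.
Qed.

Let hcoord_series v w k (t : R) n :
  hcoord k (v * series (hcexp_coeff (t *: w)) n) = pseries (coeff v w k) t n.
Proof.
have L := @hcoord_linear R k.
rewrite /pseries /series /= mulr_sumr.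
elim/big_ind2: _ => [|a b a' b' <- <-|i _].
- by rewrite -(scale0r (0 : hc R)) (lin_scale_sub L) scale0r.
- by have := L 1 a a'; rewrite !scale1r.
rewrite /hcexp_coeff exprZn -!scalerAr !(lin_scale_sub L) /coeff.
by rewrite -[RHS]mulrA [RHS]mulrC -[RHS]mulrA.
Qed.

(** Shows that [limn] in [hcexp] is a genuine limit: each coordinate is a convergent real power
    series at 1, and the coordinates are reassembled in the basis. *)
Lemma hcexp_cvg w : series (hcexp_coeff w) @ \oo --> hcexp w.
Proof.
have c k : cvgn (fun n => hcoord k (series (hcexp_coeff w) n)).
  rewrite (_ : (fun n => _) = pseries (coeff 1 w k) 1) //.
  by apply/funext => n; rewrite -hcoord_series scale1r mul1r.
have : cvgn (fun n => \sum_k hcoord k (series (hcexp_coeff w) n) *: hbasis k).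
  apply: (cvgP (\sum_k limn (fun n => hcoord k (series (hcexp_coeff w) n)) *: hbasis k)).
  apply: cvg_big; first exact: add_continuous.
  by move=> k _; apply: cvgZr_tmp; exact: c.
rewrite (_ : (fun n => _) = series (hcexp_coeff w)) //.
by apply/funext => n; rewrite -hcoord_sum.
Qed.

Let lim_pseries v w k t : limn (pseries (coeff v w k) t) = hcoord k (v * hcexp (t *: w)).
Proof.
apply: cvg_lim => //.
have -> : pseries (coeff v w k) t = fun n => hcoord k (v * series (hcexp_coeff (t *: w)) n).
  by apply/funext => n; rewrite hcoord_series.
apply: lin_cvg (@hcoord_linear _ k) (le_hcoord k) _.
apply: hc_cvgM; first exact: cvg_cst.
exact: hcexp_cvg.
Qed.

(** Each coordinate is a real power series in t and is differentiated term by term. *)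
Lemma is_derive_hcexp w (t : R) :
  is_derive t (1 : R) (fun s => hcexp (s *: w)) (w * hcexp (t *: w)).
Proof.
apply: hcoord_is_derive => k.
have -> : (fun s => hcoord k (hcexp (s *: w))) = fun s => limn (pseries (coeff 1 w k) s).
  by apply/funext => s; rewrite lim_pseries mul1r.
(* Since (n+1)/(n+1)! = 1/n!, termwise differentiation only turns the left factor u into u w, so the
   derived series are again covered by [coeff_cvg]. *)
have dE u : pseries_diffs (coeff u w k) = coeff (u * w) w k.
  apply/funext => n; rewrite /pseries_diffs /coeff factS natrM invfM.
  by rewrite mulrCA mulVKf ?pnatr_eq0 // exprS mulrA.
have -> : hcoord k (w * hcexp (t *: w)) = limn (pseries (pseries_diffs (coeff 1 w k)) t).
  by rewrite dE lim_pseries mul1r.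
(* Any radius strictly larger than |t| would do. *)
apply: (@pseries_snd_diffs _ _ (`|t| + 1)); rewrite ?dE; try exact: coeff_cvg.
by rewrite [ltRHS]ger0_norm ?addr_ge0 // ltrDl.
Qed.

Lemma hcexp0 : hcexp 0 = 1.
Proof.
(* The partial sum of index 0 is empty and equals 0; only after a shift is the sequence constantly
   1. *)
apply: cvg_lim => //; rewrite -(cvg_shiftS) /=.
rewrite (_ : (fun n => _) = cst 1); first exact: cvg_cst.
apply/funext => n; rewrite /series /= big_nat_recl //= big1 ?addr0.
  by rewrite /hcexp_coeff expr0 fact0 invr1 scale1r.
by move=> i _; rewrite /hcexp_coeff expr0n /= scaler0.
Qed.

Lemma commrZ v w (t : R) : GRing.comm v w -> GRing.comm v (t *: w).
Proof. by rewrite /GRing.comm -scalerAl -scalerAr => ->. Qed.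

(** [v] commutes with every partial sum, and multiplication by [v] on either side is continuous. *)
Lemma hcexp_comm v w : GRing.comm v w -> GRing.comm v (hcexp w).
Proof.
move=> vw.
have c1 : v * series (hcexp_coeff w) n @[n --> \oo] --> v * hcexp w.
  by apply: hc_cvgM; [exact: cvg_cst|exact: hcexp_cvg].
have c2 : series (hcexp_coeff w) n * v @[n --> \oo] --> hcexp w * v.
  by apply: hc_cvgM; [exact: hcexp_cvg|exact: cvg_cst].
rewrite /GRing.comm -(cvg_lim _ c1) // -(cvg_lim _ c2) //; congr (limn _).
apply/funext => n; rewrite /series /= mulr_sumr mulr_suml.
by apply: eq_bigr => i _; rewrite -scalerAr -scalerAl (commrX i vw).
Qed.

(* Both hcexp(tu) hcexp(-tu) and hcexp(-tw) hcexp(-tv) hcexp(t(v + w)) have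
   zero derivative in t. *)
Lemma hcexpD v w : GRing.comm v w -> hcexp (v + w) = hcexp v * hcexp w.
Proof.
have expN u : hcexp u * hcexp (- u) = 1.
  pose f (t : R) := hcexp (t *: u) * hcexp (t *: - u).
  have df (t : R) : is_derive t (1 : R) f 0.
    apply: is_derive_eq (is_derive_hcM (is_derive_hcexp u t) (is_derive_hcexp (- u) t)) _.
    rewrite mulNr mulrN mulrA; apply/eqP; rewrite subr_eq0; apply/eqP.
    by congr (_ * _); apply: hcexp_comm; rewrite /GRing.comm -scalerAl -scalerAr.
  have := is_derive_zero_eq ler01 (fun t _ => df t).
  by rewrite /f !scale1r !scale0r hcexp0 mulr1 => <-.
move=> vw.
have vwv : GRing.comm (v + w) v by apply/commr_sym; apply: commrD.
have vww : GRing.comm (v + w) w by apply/commr_sym; apply: commrD => //; exact: commr_sym.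
pose g (t : R) := hcexp (t *: - w) * hcexp (t *: - v) * hcexp (t *: (v + w)).
have dg (t : R) : is_derive t (1 : R) g 0.
  apply: is_derive_eq (is_derive_hcM (is_derive_hcM (is_derive_hcexp (- w) t)
    (is_derive_hcexp (- v) t)) (is_derive_hcexp (v + w) t)) _.
  set A := hcexp (t *: - w); set B := hcexp (t *: - v); set C := hcexp _.
  have AV : GRing.comm (- v) A.
    apply: hcexp_comm; apply: commrZ; apply: commrN.
    by apply/commr_sym/commrN/commr_sym.
  have BW : GRing.comm (v + w) (A * B).
    by apply: commrM; apply: hcexp_comm; apply: commrZ; apply: commrN.
  have -> : A * (- v * B) = - v * (A * B) by rewrite mulrA -AV mulrA.
  have -> : A * B * ((v + w) * C) = (v + w) * (A * B * C) by rewrite mulrA -BW !mulrA.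
  by rewrite -(mulrA (- w)) -mulrDl -[_ * C]mulrA -mulrDl -opprD (addrC w) addNr mul0r.
(* Comparing t = 0 with t = 1 gives exp(-w) exp(-v) exp(v + w) = 1; then exp(w) and exp(v) are
   multiplied on the left. *)
have := is_derive_zero_eq ler01 (fun t _ => dg t).
rewrite /g !scale1r !scale0r hcexp0 !mulr1 => /esym e.
have := congr1 (fun x => hcexp v * (hcexp w * x)) e.
by rewrite !mulrA mulr1 -(mulrA (hcexp v)) expN mulr1 expN mul1r.
Qed.

End HcExp.

(** * Holomorphic stem functions *)

Section Stems.
Context {R : realType}.
Implicit Types (p q : quat R) (v : hc R) (z : R * R) (D : set (R * R))
  (F G : R * R -> hc R).

Definition hcC q : hc R := (q, 0).
Definition hcI : hc R := (0, 1).
(** The variable alpha + iota beta, which is the stem of the identity x ([slice_eval_hcZX]). *)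
Definition hcZ z : hc R := z.1%:A + z.2 *: hcI.

Lemma hc_iotaE v : hc_iota v = hcI * v.
Proof. by rewrite -hc_mulE /hc_mul /= !mul0r !mul1r sub0r add0r. Qed.

Lemma hcI_comm v : GRing.comm v hcI.
Proof.
by rewrite /GRing.comm -!hc_mulE /hc_mul /= !(mul0r, mul1r, mulr0, mulr1) !add0r addr0.
Qed.

Lemma hcI_sqr : hcI * hcI = -1.
Proof.
rewrite -hc_mulE /hc_mul /= !mul0r !mul1r sub0r addr0.
by congr (_, _); rewrite /= oppr0.
Qed.

Lemma hcZ_comm z v : GRing.comm v (hcZ z).
Proof.
rewrite /hcZ; apply: commrD; first by rewrite /GRing.comm -scalerAr -scalerAl mulr1 mul1r.
by rewrite /GRing.comm -scalerAr -scalerAl hcI_comm.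
Qed.

Lemma hcZE z : hcZ z = (z.1%:A, z.2%:A).
Proof. by congr (_, _); rewrite /= scaler0 ?addr0 ?add0r. Qed.

Lemma hcCM p q : hcC (p * q) = hcC p * hcC q.
Proof. by rewrite -hc_mulE /hc_mul /= !mulr0 !mul0r subr0 addr0. Qed.

Lemma hcCX q n : hcC (q ^+ n) = hcC q ^+ n.
Proof. by elim: n => // n ih; rewrite !exprS hcCM ih. Qed.

(** The derivative [F'] is an explicit parameter, and the Cauchy-Riemann equation is the shared [F']
    in both partial derivatives. Continuity is asked of [F'], as in [class_C1]; that of [F] is
    tracked separately by [contin]. *)
Definition holo D F F' := forall z, D z ->
  [/\ is_derive z (1 : R, 0 : R) F (F' z),
      is_derive z (0 : R, 1 : R) F (hcI * F' z) & {for z, continuous F'}].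

Definition contin D F := forall z, D z -> {for z, continuous F}.

Lemma near_open D z (P : R * R -> Prop) :
  open D -> D z -> (forall w, D w -> P w) -> \near z, P z.
Proof. by move=> oD Dz DP; apply: filterS DP _; exact: open_nbhs_nbhs. Qed.

Lemma holo_ext D F G F' : open D -> (forall z, D z -> F z = G z) ->
  holo D F F' -> holo D G F'.
Proof.
move=> oD FG hF z Dz; have [da db c] := hF z Dz.
have nFG := near_open oD Dz FG.
by split=> //; apply: near_eq_is_derive nFG _.
Qed.

Lemma holo_eq_deriv D F F' G' : open D -> (forall z, D z -> F' z = G' z) ->
  holo D F F' -> holo D F G'.
Proof.
move=> oD FG hF z Dz; have [da db c] := hF z Dz.
split; [by rewrite -FG|by rewrite -FG|].
have : G' t @[t --> z] --> F' z.
  by apply: cvg_trans c; apply: near_eq_cvg; exact: near_open oD Dz FG.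
by rewrite FG.
Qed.

Lemma holo_C1 D F : class_C1 D F ->
  (forall z, D z -> d_zbar F z = 0) -> holo D F (d_alpha F).
Proof.
move=> C1 zb z Dz; have [da db ca _] := C1 z Dz.
split.
- exact: (DeriveDef da).
(* The equation gives d_alpha F = - iota d_beta F; multiplying by iota yields d_beta F. *)
- have := zb z Dz => /eqP.
  rewrite /d_zbar scaler_eq0 invr_eq0 pnatr_eq0 [_ || _]/= hc_iotaE addr_eq0 => /eqP ->.
  rewrite mulrN mulrA hcI_sqr mulN1r opprK; exact: (DeriveDef db).
- exact: ca.
Qed.

Lemma C1_holo D F F' : open D -> holo D F F' ->
  [/\ class_C1 D F, forall z, D z -> d_zbar F z = 0 &
      forall z, D z -> d_z F z = F' z].
Proof.
move=> oD hF.
have daE z : D z -> d_alpha F z = F' z.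
  by move=> /hF[da _ _]; exact: derive_val.
have dbE z : D z -> d_beta F z = hcI * F' z.
  by move=> /hF[_ db _]; exact: derive_val.
split=> z Dz.
- have [da db c] := hF z Dz; split; [exact: ex_derive|exact: ex_derive| |].
    have e : \near z, F' z = d_alpha F z.
      by apply: near_open oD Dz _ => w /daE.
    have : d_alpha F t @[t --> z] --> F' z by apply: cvg_trans c; apply: near_eq_cvg.
    by rewrite -(daE _ Dz).
  have e : \near z, hcI * F' z = d_beta F z.
    by apply: near_open oD Dz _ => w /dbE.
  have c' : hcI * F' t @[t --> z] --> hcI * F' z by apply: hc_cvgM => //; exact: cvg_cst.
  have : d_beta F t @[t --> z] --> hcI * F' z by apply: cvg_trans c'; apply: near_eq_cvg.
  by rewrite -(dbE _ Dz).
- by rewrite /d_zbar daE // dbE // hc_iotaE mulrA hcI_sqr mulN1r subrr scaler0.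
- have half (v : hc R) : 2^-1 *: (v + v) = v.
    by rewrite -[v + v]mulr2n -[v *+ 2]scaler_nat scalerA mulVf ?pnatr_eq0 // scale1r.
  by rewrite /d_z daE // dbE // hc_iotaE mulrA hcI_sqr mulN1r opprK half.
Qed.

Lemma holo_cst D v : holo D (cst v) (cst 0).
Proof.
move=> z Dz; split; first exact: is_derive_cst.
  by rewrite mulr0; exact: is_derive_cst.
exact: cvg_cst.
Qed.

Lemma contin_cst D v : contin D (cst v).
Proof. by move=> z _; exact: cvg_cst. Qed.

Lemma holoD D F G F' G' : holo D F F' -> holo D G G' ->
  holo D (fun z => F z + G z) (fun z => F' z + G' z).
Proof.
move=> hF hG z Dz; have [? ? ?] := hF z Dz; have [? ? ?] := hG z Dz.
split; [exact: is_deriveD|rewrite mulrDr; exact: is_deriveD|exact: cvgD].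
Qed.

Lemma holoN D F F' : holo D F F' -> holo D (fun z => - F z) (fun z => - F' z).
Proof.
move=> hF z Dz; have [? ? ?] := hF z Dz.
split; [exact: is_deriveN|rewrite mulrN; exact: is_deriveN|exact: cvgN].
Qed.

Lemma continM D F G : contin D F -> contin D G -> contin D (fun z => F z * G z).
Proof. by move=> cF cG z Dz; apply: hc_cvgM; [exact: cF|exact: cG]. Qed.

(** Continuity of [F] and [G] enters through that of F' G + F G'. *)
Lemma holoM D F G F' G' : contin D F -> contin D G ->
  holo D F F' -> holo D G G' ->
  holo D (fun z => F z * G z) (fun z => F' z * G z + F z * G' z).
Proof.
move=> cF cG hF hG z Dz; have [? ? ?] := hF z Dz; have [? ? ?] := hG z Dz.
split; first exact: is_derive_hcM.
  (* Centrality of iota moves it past F z, next to the derivative of G. *)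
  rewrite mulrDr !mulrA -(hcI_comm (F z)) -(mulrA (F z)); exact: is_derive_hcM.
by apply: cvgD; apply: hc_cvgM => //; [exact: cG|exact: cF].
Qed.

Lemma holo_sum D n (F F' : 'I_n -> R * R -> hc R) :
  (forall i, holo D (F i) (F' i)) ->
  holo D (fun z => \sum_i F i z) (fun z => \sum_i F' i z).
Proof.
elim: n F F' => [|n ih] F F' hF.
  rewrite (_ : (fun z => _) = cst 0); last by apply/funext => z; rewrite big_ord0.
  rewrite (_ : (fun z => _) = cst 0); last by apply/funext => z; rewrite big_ord0.
  exact: holo_cst.
have E (H : 'I_n.+1 -> R * R -> hc R) :
    (fun z => \sum_i H i z) = fun z => H ord0 z + \sum_i H (lift ord0 i) z.
  by apply/funext => z; rewrite big_ord_recl.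
rewrite !E.
by apply: holoD => //; apply: ih.
Qed.

(** * The exponential stem and the powers of z *)

Lemma is_derive_fst {W : normedModType R} (f : R -> W) z df :
  is_derive z.1 (1 : R) f df ->
  is_derive z (1 : R, 0 : R) (fun w => f w.1) df /\
  is_derive z (0 : R, 1 : R) (fun w => f w.1) 0.
Proof.
move=> /is_deriveP cf; split; apply/is_deriveP => //=.
rewrite (_ : (fun h => _) = cst 0); first exact: cvg_cst.
by apply/funext => h /=; rewrite scaler0 add0r subrr scaler0.
Qed.

Lemma is_derive_snd {W : normedModType R} (f : R -> W) z df :
  is_derive z.2 (1 : R) f df ->
  is_derive z (0 : R, 1 : R) (fun w => f w.2) df /\
  is_derive z (1 : R, 0 : R) (fun w => f w.2) 0.
Proof.
move=> /is_deriveP cf; split; apply/is_deriveP => //=.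
rewrite (_ : (fun h => _) = cst 0); first exact: cvg_cst.
by apply/funext => h /=; rewrite scaler0 add0r subrr scaler0.
Qed.

Lemma continuous_hcexp v (t : R) : {for t, continuous (fun s : R => hcexp (s *: v))}.
Proof.
apply: differentiable_continuous; apply/derivable1_diffP.
have h := is_derive_hcexp v t; exact: ex_derive.
Qed.

Definition exp_stem (q : quat R) z : hc R := hcexp (hcZ z * hcC q).

(** As q and iota q commute, the exponential splits into one factor in alpha and one in beta, each a
    curve covered by [is_derive_hcexp]. *)
Lemma exp_stemE q z : exp_stem q z = hcexp (z.1 *: hcC q) * hcexp (z.2 *: (hcI * hcC q)).
Proof.
rewrite /exp_stem /hcZ mulrDl -!scalerAl mul1r; apply: hcexpD.
apply: commrZ; apply/commr_sym/commrZ; apply: commr_sym.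
by apply: commrM => //; exact: hcI_comm.
Qed.

Lemma contin_exp q D : contin D (exp_stem q).
Proof.
rewrite (_ : exp_stem q =
    fun z => hcexp (z.1 *: hcC q) * hcexp (z.2 *: (hcI * hcC q))); last first.
  by apply/funext => z; exact: exp_stemE.
move=> z _; apply: hc_cvgM.
  have c1 : (fun t : R * R => t.1) @ z --> z.1 by exact: cvg_fst.
  exact: (cvg_comp _ _ c1 (@continuous_hcexp (hcC q) z.1)).
have c2 : (fun t : R * R => t.2) @ z --> z.2 by exact: cvg_snd.
exact: (cvg_comp _ _ c2 (@continuous_hcexp (hcI * hcC q) z.2)).
Qed.

Lemma exp_stem_comm p q z : GRing.comm p q -> GRing.comm (hcC p) (exp_stem q z).
Proof.
move=> pq; apply: hcexp_comm; apply: commrM; first exact: hcZ_comm.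
by rewrite /GRing.comm -!hcCM pq.
Qed.

Lemma holo_exp q D : holo D (exp_stem q) (fun z => exp_stem q z * hcC q).
Proof.
move=> z Dz; have [a1 b1] := is_derive_fst (is_derive_hcexp (hcC q) z.1).
have [b2 a2] := is_derive_snd (is_derive_hcexp (hcI * hcC q) z.2).
have E : exp_stem q = fun z => hcexp (z.1 *: hcC q) * hcexp (z.2 *: (hcI * hcC q)).
  by apply/funext => w; exact: exp_stemE.
have C := @exp_stem_comm q q z erefl.
rewrite -C; split.
- rewrite [X in is_derive _ _ X]E.
  apply: is_derive_eq (is_derive_hcM a1 a2) _.
  by rewrite mulr0 addr0 exp_stemE mulrA.
- rewrite [X in is_derive _ _ X]E.
  apply: is_derive_eq (is_derive_hcM b1 b2) _.
  rewrite mul0r add0r exp_stemE mulrA.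
  set A := hcexp (z.1 *: _).
  (* Differentiating in beta leaves iota q between the two factors; it commutes with the first and
     is brought to the left. *)
  have CA : GRing.comm (hcI * hcC q) A.
    apply: hcexp_comm; apply: commrZ; apply/commr_sym/commrM => //; exact: hcI_comm.
  by rewrite -CA !mulrA.
- exact: (continM (@contin_exp q D) (@contin_cst D (hcC q)) Dz).
Qed.

Lemma contin_hcZ D : contin D hcZ.
Proof.
move=> z _; apply: cvgD; apply: cvgZr_tmp; [exact: cvg_fst|exact: cvg_snd].
Qed.

Lemma holo_hcZ D : holo D hcZ (cst 1).
Proof.
move=> z Dz.
have d v (t : R) : is_derive t (1 : R) (fun s => s *: v : hc R) v.
  apply/is_deriveP; apply: cvg_near_cst; near=> h.
  rewrite scalerDl addrK scalerA [h%:A]mulr1 mulVf ?scale1r //.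
  by near: h; exact: nbhs_dnbhs_neq.
have [a1 b1] := is_derive_fst (d 1 z.1); have [b2 a2] := is_derive_snd (d hcI z.2).
split; [| |exact: cvg_cst].
  by apply: is_derive_eq (is_deriveD a1 a2) _; rewrite addr0.
by apply: is_derive_eq (is_deriveD b1 b2) _; rewrite add0r mulr1.
Unshelve. all: by end_near. Qed.

Lemma contin_hcZX D n : contin D (fun z => hcZ z ^+ n).
Proof.
elim: n => [|n ih]; first exact: contin_cst.
rewrite (_ : (fun z => _) = fun z => hcZ z * hcZ z ^+ n).
  by apply: continM => //; exact: contin_hcZ.
by apply/funext => z; rewrite exprS.
Qed.

Lemma holo_hcZX D n : holo D (fun z => hcZ z ^+ n.+1) (fun z => n.+1%:R *: hcZ z ^+ n).
Proof.
elim: n => [|n ih].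
  rewrite (_ : (fun z => _ *: _) = cst 1); first exact: holo_hcZ.
  by apply/funext => z; rewrite expr0 scale1r.
rewrite (_ : (fun z => hcZ z ^+ n.+2) = fun z => hcZ z * hcZ z ^+ n.+1); last first.
  by apply/funext => z; rewrite exprS.
have := holoM (@contin_hcZ D) (@contin_hcZX D n.+1) (@holo_hcZ D) ih.
congr (holo _ _ _); apply/funext => z /=.
by rewrite mul1r -scalerAr -exprS -{1}[_ ^+ _]scale1r -scalerDl nat1r.
Qed.

End Stems.

(** * Slice functions *)

Section Slices.
Context {R : realType}.
Implicit Types (p q J x : quat R) (v u w : hc R) (z : R * R) (D : set (R * R))
  (F G : R * R -> hc R) (f g : quat R -> quat R).

Definition slice_pt x : R * R := (qre x, imag_norm x).

(** The value on the slice of J of a function whose stem takes the value [w]. It is real linear and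
    right H-linear ([slice_eval_hcC]), but not multiplicative in general. *)
Definition slice_eval J w : quat R := w.1 + J * w.2.

Lemma slice_eval_linear J : linear (slice_eval J).
Proof.
by move=> a v w; rewrite /slice_eval /= mulrDr scalerDr scalerAr addrACA.
Qed.

Lemma slice_evalD J v w : slice_eval J (v + w) = slice_eval J v + slice_eval J w.
Proof. by have := slice_eval_linear J 1 v w; rewrite !scale1r. Qed.

Lemma slice_evalN J v : slice_eval J (- v) = - slice_eval J v.
Proof. by rewrite -scaleN1r (lin_scale_sub (slice_eval_linear J)) scaleN1r. Qed.

Lemma slice_eval_bound J w : `|slice_eval J w| <= (1 + `|J|) * `|w|.
Proof.
apply: le_trans (ler_normD _ _) _; rewrite mulrDl mul1r qnormM; apply: lerD.
  by rewrite hc_normE le_max lexx.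
by apply: ler_wpM2l => //; rewrite [leRHS]hc_normE le_max lexx orbT.
Qed.

Lemma slice_eval_hcC J w q : slice_eval J (w * hcC q) = slice_eval J w * q.
Proof. by rewrite -hc_mulE /slice_eval /hc_mul /= !mulr0 subr0 add0r mulrDl mulrA. Qed.

Lemma imag_norm_ge0 x : 0 <= imag_norm x.
Proof. exact: sqrtr_ge0. Qed.

Lemma imag_norm_sqr x : imag_norm x ^+ 2 = qi x ^+ 2 + qj x ^+ 2 + qk x ^+ 2.
Proof. by rewrite sqr_sqrtr // !addr_ge0 ?sqr_ge0. Qed.

Lemma imag_norm_eq0 x : imag_norm x = 0 -> x = (qre x)%:A.
Proof.
move=> n0; have := imag_norm_sqr x; rewrite n0 expr0n /= => /esym/eqP.
rewrite !paddr_eq0 ?addr_ge0 ?sqr_ge0 // !sqrf_eq0 => /andP[/andP[/eqP i0 /eqP j0] /eqP k0].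
by apply: quatP; split; rewrite /= ?mulr1 ?mulr0.
Qed.

Lemma imag_dir_unit x : imag_norm x != 0 -> imag_units (imag_dir x).
Proof.
move=> n0; apply/imag_unitsP; rewrite /= mulr0; split => //.
rewrite !exprMn -!mulrDr -imag_norm_sqr exprVn mulVf //.
by rewrite sqrf_eq0.
Qed.

Lemma slice_pt_dir x : x = (slice_pt x).1%:A + (slice_pt x).2 *: imag_dir x.
Proof.
have [/eqP n0|n0] := boolP (imag_norm x == 0).
  by rewrite /= n0 scale0r addr0; exact: imag_norm_eq0.
rewrite /imag_dir /= scalerA mulfV // scale1r.
by apply: quatP; split; rewrite /=; ring.
Qed.

Lemma slice_pt_unit x :
  exists2 J, imag_units J & x = (slice_pt x).1%:A + (slice_pt x).2 *: J.
Proof.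
have [/eqP n0|n0] := boolP (imag_norm x == 0); last first.
  by exists (imag_dir x); [exact: imag_dir_unit|exact: slice_pt_dir].
(* For real x, [imag_dir x] is 0 and not an imaginary unit; any unit serves there, since its
   coefficient vanishes. *)
exists (Quat 0 1 0 0); first by apply/imag_unitsP; split => /=; ring.
by rewrite /= n0 scale0r addr0; exact: imag_norm_eq0.
Qed.

(* Since [imag_dir x] is 0 for real x, J^2 = -1 only holds after scaling by the
   imaginary part of x. *)
Lemma slice_eval_hcZ x w :
  slice_eval (imag_dir x) (hcZ (slice_pt x) * w) = x * slice_eval (imag_dir x) w.
Proof.
set J := imag_dir x; set z := slice_pt x.
have J2 : z.2 *: (J * J) = - (z.2)%:A.
  have [/eqP n0|n0] := boolP (imag_norm x == 0).
    by rewrite /z /= n0 !scale0r oppr0.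
  by rewrite -expr2 (imag_dir_unit n0) scalerN.
rewrite [in RHS](slice_pt_dir x) -/J -/z; clearbody J z.
rewrite hcZE -hc_mulE /slice_eval /hc_mul /=.
rewrite !mulrDl !mulrDr -!scalerAl !mul1r -!scalerAr.
have -> : z.2 *: (J * (J * w.2)) = - (z.2 *: w.2).
  by rewrite mulrA scalerAl J2 mulNr -scalerAl mul1r.
by rewrite addrACA; congr (_ + _); rewrite addrC.
Qed.

Lemma slice_eval_hcZX x n : slice_eval (imag_dir x) (hcZ (slice_pt x) ^+ n) = x ^+ n.
Proof.
elim: n => [|n ih]; first by rewrite /slice_eval !expr0 /= mulr0 addr0.
by rewrite !exprS slice_eval_hcZ ih.
Qed.

Lemma slice_pt_circ D x : conj_invariant D -> circularization D x -> D (slice_pt x).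
Proof.
move=> cD [z [J [Dz SJ ->]]]; have [z1 zi zj zk] := slice_coordE z SJ.
have /imag_unitsP [_ nJ] := SJ.
rewrite /slice_pt z1 /imag_norm zi zj zk !exprMn -!mulrDr nJ mulr1 sqrtr_sqr.
have [b0|b0] := ltP z.2 0; last by rewrite ger0_norm // -surjective_pairing.
by rewrite ltr0_norm //; exact: cD.
Qed.

Lemma circ_slice D z J : D z -> imag_units J -> circularization D (z.1%:A + z.2 *: J).
Proof. by move=> Dz SJ; exists z, J. Qed.

Lemma induces_slice_of D F : conj_invariant D -> stem_function D F ->
  induces (circularization D) F (slice_of F).
Proof. by move=> cD sF; split => //; rewrite shadow_circularization. Qed.

(** [stem_of] selects some inducing stem, and [induces_unique] identifies it with [F] on [D]. *)
Lemma stem_ofE D F f z : conj_invariant D -> induces (circularization D) F f ->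
  D z -> stem_of (circularization D) f z = F z.
Proof.
move=> cD iF; rewrite /stem_of; case: xgetP => [G _ iG|/(_ F) //].
exact: (induces_unique cD iG iF).
Qed.

Lemma slice_of_eq0 D F : conj_invariant D -> stem_function D F ->
  (forall x, circularization D x -> slice_of F x = 0) -> forall z, D z -> F z = 0.
Proof.
move=> cD sF F0 z Dz.
apply: (@induces_unique _ D F (cst 0) (cst 0) cD) => //.
  by split=> [|x Ox]; [rewrite shadow_circularization|rewrite F0].
split=> [t _|x _]; first by rewrite /hc_conj /= oppr0.
by rewrite /slice_of /= mulr0 addr0.
Qed.

(** * Conjugation and the symmetry of stem functions *)

Lemma hc_conjM v w : hc_conj (v * w) = hc_conj v * hc_conj w.
Proof. by rewrite -!hc_mulE /hc_conj /hc_mul /= mulrNN mulrN mulNr opprD. Qed.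

Lemma hc_conj_linear : linear (@hc_conj R).
Proof. by move=> a v w; congr (_, _); rewrite /= opprD scalerN. Qed.

Lemma hc_conjD v w : hc_conj (v + w) = hc_conj v + hc_conj w.
Proof. by have := hc_conj_linear 1 v w; rewrite !scale1r. Qed.

Lemma hc_conj_scale (a : R) w : hc_conj (a *: w) = a *: hc_conj w.
Proof. by rewrite (lin_scale_sub hc_conj_linear). Qed.

Lemma hc_conj_bound w : `|hc_conj w| <= 1 * `|w|.
Proof. by rewrite mul1r !hc_normE /= normrN. Qed.

Lemma hc_conjX w n : hc_conj (w ^+ n) = hc_conj w ^+ n.
Proof.
by elim: n => [|n ih]; [rewrite !expr0 /hc_conj /= oppr0|rewrite !exprS hc_conjM ih].
Qed.

Lemma hc_conjC q : hc_conj (hcC q) = hcC q.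
Proof. by rewrite /hc_conj /= oppr0. Qed.

Lemma hc_conjZ z : hc_conj (hcZ z) = hcZ (cconj z).
Proof. by rewrite !hcZE /hc_conj /= scaleNr. Qed.

(** Conjugation is a continuous real-linear ring morphism, so it passes through the exponential
    series. *)
Lemma hc_conj_exp w : hc_conj (hcexp w) = hcexp (hc_conj w).
Proof.
have c : hc_conj (series (hcexp_coeff w) n) @[n --> \oo] --> hc_conj (hcexp w).
  exact: lin_cvg hc_conj_linear hc_conj_bound (@hcexp_cvg _ w).
rewrite -(cvg_lim _ c) //; congr (limn _); apply/funext => n.
rewrite /series /=; elim/big_ind2: _ => [|a a' b b' <- <-|i _].
- by rewrite /hc_conj /= oppr0.
- by rewrite hc_conjD.
by rewrite /hcexp_coeff hc_conj_scale hc_conjX.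
Qed.

Lemma stem_exp D q : stem_function D (exp_stem q).
Proof. by move=> z _; rewrite /exp_stem hc_conj_exp hc_conjM hc_conjC hc_conjZ. Qed.

Lemma stemM D F G : stem_function D F -> stem_function D G ->
  stem_function D (fun z => F z * G z).
Proof. by move=> sF sG z Dz; rewrite hc_conjM sF // sG. Qed.

Lemma stemD D F G : stem_function D F -> stem_function D G ->
  stem_function D (fun z => F z + G z).
Proof. by move=> sF sG z Dz; rewrite sF // sG // hc_conjD. Qed.

Lemma stemN D F : stem_function D F -> stem_function D (fun z => - F z).
Proof. by move=> sF z Dz; rewrite sF. Qed.

Lemma stemC D q : stem_function D (cst (hcC q)).
Proof. by move=> z _; rewrite hc_conjC. Qed.

Lemma stem_hcZX D n : stem_function D (fun z => hcZ z ^+ n).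
Proof. by move=> z _; rewrite hc_conjX hc_conjZ. Qed.

Lemma stem_sum D n (F : 'I_n -> R * R -> hc R) :
  (forall i, stem_function D (F i)) -> stem_function D (fun z => \sum_i F i z).
Proof.
move=> sF z Dz; elim/big_ind2: _ => [|a a' b b' -> ->|i _].
- by rewrite /hc_conj /= oppr0.
- by rewrite hc_conjD.
exact: sF.
Qed.

(** F(conj z) = conj F(z) is differentiated along alpha, a direction that conjugation fixes. This
    makes [slice_of_eq0] applicable to derivatives. *)
Lemma stem_holo D F F' : open D -> conj_invariant D -> stem_function D F ->
  holo D F F' -> stem_function D F'.
Proof.
move=> oD cD sF hF z Dz; have [da _ _] := hF z Dz; have [da' _ _] := hF _ (cD _ Dz).
have cK : involutive (@cconj R) by move=> [a b]; rewrite /cconj /= opprK.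
have vK : involutive (@hc_conj R) by move=> [a b]; rewrite /hc_conj /= opprK.
have dc : is_derive (cconj z) (1 : R, 0 : R) (fun t => hc_conj (F (cconj t))) (hc_conj (F' z)).
  have /is_deriveP dz := is_derive_lin hc_conj_linear hc_conj_bound da.
  apply/is_deriveP; apply: cvg_trans dz; apply: near_eq_cvg; apply: nearW => h /=.
  rewrite cK; congr (_ *: (hc_conj (F _) - _)).
  by rewrite /cconj /=; congr (_, _); rewrite /= scaler0 !add0r opprK.
have n : \forall t \near cconj z, hc_conj (F (cconj t)) = F t.
  by apply: near_open oD (cD _ Dz) _ => t Dt; rewrite sF.
have dc' := near_eq_is_derive n dc.
by rewrite -(@derive_val _ _ _ _ _ _ _ da') (@derive_val _ _ _ _ _ _ _ dc').
Qed.

(** * Translation of slice-regularity, slice-constancy and the differential equation into stems *)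

Lemma slice_regularP D f : open D -> conj_invariant D ->
  slice_regular (circularization D) f <->
  exists F F', induces (circularization D) F f /\ holo D F F'.
Proof.
move=> oD cD; rewrite /slice_regular shadow_circularization //; split.
  by move=> [F [iF C1 zb]]; exists F, (d_alpha F); split => //; exact: holo_C1.
by move=> [F [F' [iF hF]]]; exists F; have [] := C1_holo oD hF.
Qed.

Lemma slice_derivE D F F' f x : open D -> conj_invariant D ->
  induces (circularization D) F f -> holo D F F' -> circularization D x ->
  slice_deriv (circularization D) f x = slice_of F' x.
Proof.
move=> oD cD iF hF Ox; have Dx := slice_pt_circ cD Ox.
(* The chosen stem agrees with [F] on the open set [D] only, which is enough to have the same
   derivative there. *)
have hS : holo D (stem_of (circularization D) f) F'.
  by apply: holo_ext oD _ hF => z Dz; rewrite (stem_ofE cD iF).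
have [_ _ dz] := C1_holo oD hS.
by rewrite /slice_deriv /slice_of -/(slice_pt x) dz.
Qed.

Lemma slice_prodE D F G f g x : conj_invariant D ->
  induces (circularization D) F f -> induces (circularization D) G g ->
  circularization D x ->
  slice_prod (circularization D) f g x = slice_of (fun z => F z * G z) x.
Proof.
move=> cD iF iG Ox; have Dx := slice_pt_circ cD Ox.
by rewrite /slice_prod /slice_of -/(slice_pt x) (stem_ofE cD iF) // (stem_ofE cD iG).
Qed.

Lemma slice_constantP D g : open D -> conj_invariant D ->
  slice_constant (circularization D) g <->
  exists G, induces (circularization D) G g /\ holo D G (cst 0).
Proof.
move=> oD cD; split.
  move=> [/(slice_regularP _ oD cD) [G [G' [iG hG]]] d0]; exists G; split => //.
  have sG : stem_function D G by case: iG; rewrite shadow_circularization.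
  apply: (holo_eq_deriv oD _ hG); apply: (slice_of_eq0 cD (stem_holo oD cD sG hG)).
  by move=> x Ox; rewrite -(slice_derivE oD cD iG hG Ox) d0.
move=> [G [iG hG]]; split; first by apply/slice_regularP => //; exists G, (cst 0).
move=> x Ox; rewrite (slice_derivE oD cD iG hG Ox).
by rewrite /slice_of /= mulr0 addr0.
Qed.

(** The defect F' - (F lambda + H) is itself a stem function, so it vanishes as soon as the slice
    function that it induces does. *)
Lemma D_solutionP D lam (h f : quat R -> quat R) H : open D -> conj_invariant D ->
  stem_function D H -> (forall x, h x = slice_of H x) ->
  D_solution (circularization D) lam h f <->
  exists F, induces (circularization D) F f /\
    holo D F (fun z => F z * hcC lam + H z).
Proof.
move=> oD cD sH hH; split.
  move=> [/(slice_regularP _ oD cD) [F [F' [iF hF]]] Df]; exists F; split => //.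
  have [sF fF] := iF; rewrite shadow_circularization // in sF.
  apply: (holo_eq_deriv oD _ hF) => z Dz; apply/eqP; rewrite -subr_eq0; apply/eqP.
  have sW : stem_function D (fun z => F' z - (F z * hcC lam + H z)).
    apply: stemD; first exact: stem_holo hF.
    by apply/stemN/stemD => //; apply: stemM => //; exact: stemC.
  apply: (slice_of_eq0 cD sW) Dz => x Ox.
  have := Df x Ox; rewrite /D_op (slice_derivE oD cD iF hF Ox) hH fF // /slice_of.
  rewrite -/(slice_pt x) -/(slice_eval _ (F' _)) -/(slice_eval _ (F _)).
  rewrite -/(slice_eval _ (H _)) -/(slice_eval _ (_ - _)) => e.
  by rewrite slice_evalD slice_evalN slice_evalD slice_eval_hcC opprD addrA e subrr.
move=> [F [iF hF]]; split.
  by apply/slice_regularP => //; exists F; eexists; split; [exact: iF|exact: hF].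
move=> x Ox; have [_ fF] := iF.
rewrite /D_op (slice_derivE oD cD iF hF Ox) hH fF //.
rewrite /slice_of -/(slice_pt x) -/(slice_eval _ (F _)).
rewrite -/(slice_eval _ (_ + _)) -/(slice_eval _ (H _)).
by rewrite slice_evalD slice_eval_hcC addrAC subrr add0r.
Qed.

End Slices.

(** * The particular solution *)

Section Solutions.
Context {R : realType}.
Implicit Types (p q J x lam : quat R) (v u w : hc R) (z : R * R) (D : set (R * R))
  (F G : R * R -> hc R) (f g : quat R -> quat R).

Lemma slice_of_eval F x : slice_of F x = slice_eval (imag_dir x) (F (slice_pt x)).
Proof. by []. Qed.

(** Evaluation on a slice is continuous and linear, and sends z^n lambda^n to x^n lambda^n. This
    also settles the convergence of the series in [exp_slice]. *)
Lemma exp_sliceE lam x : exp_slice lam x = slice_of (exp_stem lam) x.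
Proof.
rewrite slice_of_eval; set J := imag_dir x; set w := hcZ (slice_pt x) * hcC lam.
have c : slice_eval J (series (hcexp_coeff w) n) @[n --> \oo] --> slice_eval J (hcexp w).
  exact: lin_cvg (slice_eval_linear J) (@slice_eval_bound _ J) (@hcexp_cvg _ w).
rewrite /exp_stem -/w -(cvg_lim _ c) //; congr (limn _); apply/funext => n.
rewrite /series /=; elim/big_ind2: _ => [|a a' b b' -> ->|i _].
- by rewrite /slice_eval /= mulr0 addr0.
- by rewrite slice_evalD.
rewrite /hcexp_coeff /w exprMn_comm; last exact/commr_sym/hcZ_comm.
by rewrite -hcCX [RHS](lin_scale_sub (slice_eval_linear J)) slice_eval_hcC slice_eval_hcZX.
Qed.

Lemma hcCN q : hcC (- q) = - hcC q.
Proof. by congr (_, _); rewrite /= oppr0. Qed.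

Lemma hcC_nat n : hcC n%:R = n%:R :> hc R.
Proof.
elim: n => // n ih; rewrite -!natr1 -ih; congr (_, _); rewrite /= addr0 //.
Qed.

Lemma exp_stemK q z : exp_stem q z * exp_stem (- q) z = 1.
Proof.
rewrite /exp_stem -hcexpD; last by rewrite hcCN mulrN; apply: commrN.
by rewrite -mulrDr hcCN subrr mulr0 hcexp0.
Qed.

Lemma exp_stemVK q z : exp_stem (- q) z * exp_stem q z = 1.
Proof. by rewrite -{2}(opprK q) exp_stemK. Qed.

Definition trunc_stem lam n z : hc R :=
  \sum_(k < n.+1) k`!%:R^-1 *: (hcZ z ^+ k * hcC lam ^+ k).

Lemma exp_truncE lam n x : exp_trunc lam n x = slice_of (trunc_stem lam n) x.
Proof.
rewrite slice_of_eval /exp_trunc /trunc_stem; set J := imag_dir x.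
elim/big_ind2: _ => [|a a' b b' -> ->|i _].
- by rewrite /slice_eval /= mulr0 addr0.
- by rewrite slice_evalD.
by rewrite -hcCX [RHS](lin_scale_sub (slice_eval_linear J)) slice_eval_hcC slice_eval_hcZX.
Qed.

Lemma stemZ D (a : R) F : stem_function D F -> stem_function D (fun z => a *: F z).
Proof. by move=> sF z Dz; rewrite hc_conj_scale sF. Qed.

Lemma stem_trunc D lam n : stem_function D (trunc_stem lam n).
Proof.
apply: stem_sum => k; apply: stemZ; apply: stemM; first exact: stem_hcZX.
by move=> z _; rewrite -hcCX hc_conjC.
Qed.

Lemma trunc_stem_recr lam n : trunc_stem lam n.+1 =
  fun z => trunc_stem lam n z + hcZ z ^+ n.+1 * (n.+1`!%:R^-1 *: hcC lam ^+ n.+1).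
Proof.
apply/funext => z; rewrite /trunc_stem big_ord_recr /=; congr (_ + _).
by rewrite scalerAr.
Qed.

Lemma trunc_stem0 lam : trunc_stem lam 0 = cst 1.
Proof.
apply/funext => z; rewrite /trunc_stem big_ord_recl big_ord0.
by rewrite !expr0 fact0 invr1 scale1r mulr1 addr0.
Qed.

Lemma contin_trunc D lam n : contin D (trunc_stem lam n).
Proof.
elim: n => [|n ih]; first by rewrite trunc_stem0; exact: contin_cst.
rewrite trunc_stem_recr => z Dz; apply: cvgD; first exact: ih.
exact: (continM (@contin_hcZX _ D n.+1) (@contin_cst _ D _) Dz).
Qed.

(** The derivative of the truncation T_n is T_{n-1} lambda; writing T_{n-1} as T_n minus its last
    term includes n = 0, where it is 0. *)
Lemma holo_trunc D lam n : open D -> holo D (trunc_stem lam n)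
  (fun z => (trunc_stem lam n z - hcZ z ^+ n * (n`!%:R^-1 *: hcC lam ^+ n)) * hcC lam).
Proof.
move=> oD; elim: n => [|n ih].
  rewrite trunc_stem0; apply: (holo_eq_deriv oD _ (@holo_cst _ D 1)) => z _ /=.
  by rewrite !expr0 fact0 invr1 scale1r mulr1 subrr mul0r.
set v := n.+1`!%:R^-1 *: hcC lam ^+ n.+1.
have hM := holoM (@contin_hcZX _ D n.+1) (@contin_cst _ D v) (@holo_hcZX _ D n) (@holo_cst _ D v).
have := holoD ih hM; rewrite -trunc_stem_recr; apply: holo_eq_deriv => // z _ /=.
rewrite [in RHS]trunc_stem_recr addrK mulr0 addr0 mulrBl -[RHS]addr0 -addrA; congr (_ + _).
apply/eqP; rewrite addrC subr_eq0; apply/eqP.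
rewrite /v -scalerAl -!scalerAr -scalerAl scalerA exprSr mulrA; congr (_ *: _).
by rewrite factS natrM invfM mulVKf // pnatr_eq0.
Qed.

Definition f_part_stem lam q n z : hc R :=
  - (hcC q * trunc_stem lam n z) * hcC (n`!%:R * lam ^- n.+1).

Lemma stem_f_part D lam q n : stem_function D (f_part_stem lam q n).
Proof.
apply: stemM; last exact: stemC.
by apply: stemN; apply: stemM; [exact: stemC|exact: stem_trunc].
Qed.

(** The last term missing from the derivative of the truncation becomes, after the normalisation,
    exactly the monomial z^n q. *)
Lemma holo_f_part D lam q n : open D -> lam != 0 -> holo D (f_part_stem lam q n)
  (fun z => f_part_stem lam q n z * hcC lam + hcZ z ^+ n * hcC q).
Proof.
move=> oD lam0.
have hA := holoM (@contin_cst _ D (hcC q)) (@contin_trunc D lam n)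
  (@holo_cst _ D (hcC q)) (@holo_trunc D lam n oD).
have cA : contin D (fun z => - (hcC q * trunc_stem lam n z)).
  move=> z Dz; apply: cvgN.
  exact: (continM (@contin_cst _ D (hcC q)) (@contin_trunc D lam n) Dz).
have := holoM cA (@contin_cst _ D (hcC (n`!%:R * lam ^- n.+1))) (holoN hA) (@holo_cst _ D _).
apply: holo_eq_deriv => // z Dz /=.
rewrite mul0r add0r mulr0 addr0 /f_part_stem.
have lamC : GRing.comm (hcC lam) (hcC (n`!%:R * lam ^- n.+1)).
  rewrite /GRing.comm -!hcCM; congr hcC; apply: commrM.
    exact: commr_nat.
  by apply: commrV; apply: commrX.
set T := trunc_stem lam n z; set u := n`!%:R^-1 *: hcC lam ^+ n.
set N := hcC (n`!%:R * _) in lamC *; set P := hcZ z ^+ n.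
(* The factor n! lambda^{-n-1} is chosen to cancel lambda^n / n! times the lambda produced by
   differentiation. *)
have uN : u * hcC lam * N = 1.
  rewrite /u /N -!scalerAl -exprSr -hcCX -hcCM (mulr_natl _ n`!) mulrnAr.
  rewrite mulrV; last by apply: unitrX; exact: lam0.
  by rewrite hcC_nat -[X in _ *: X]scaler_nat scalerA mulVf ?scale1r // pnatr_eq0 -lt0n fact_gt0.
have PQ : hcC q * P = P * hcC q by apply: commrX; exact: hcZ_comm.
rewrite mulrBl mulrBr opprB mulrDl addrC; congr (_ + _).
  by rewrite !mulNr -!mulrA lamC.
by rewrite !mulrA PQ -2!mulrA uN mulr1.
Qed.

Lemma slice_pt_setT : [set: quat R] = circularization [set: R * R].
Proof.
apply/seteqP; split=> // x _; have [J SJ e] := slice_pt_unit x.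
by exists (slice_pt x), J.
Qed.

Definition f_star_stem lam d (c : 'I_d.+1 -> quat R) z : hc R :=
  \sum_(n < d.+1) f_part_stem lam (c n) n z.

Definition poly_stem d (c : 'I_d.+1 -> quat R) z : hc R :=
  \sum_(n < d.+1) hcZ z ^+ n * hcC (c n).

Lemma right_polyE d (c : 'I_d.+1 -> quat R) x : right_poly c x = slice_of (poly_stem c) x.
Proof.
rewrite slice_of_eval /right_poly /poly_stem.
elim/big_ind2: _ => [|a a' b b' -> ->|i _].
- by rewrite /slice_eval /= mulr0 addr0.
- by rewrite slice_evalD.
by rewrite slice_eval_hcC slice_eval_hcZX.
Qed.

Lemma conj_setT : conj_invariant [set: R * R]. Proof. by []. Qed.

Lemma f_starE lam d (c : 'I_d.+1 -> quat R) x : f_star lam c x = slice_of (f_star_stem lam c) x.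
Proof.
rewrite slice_of_eval /f_star /f_star_stem.
elim/big_ind2: _ => [|a a' b b' -> ->|i _].
- by rewrite /slice_eval /= mulr0 addr0.
- by rewrite slice_evalD.
rewrite /f_part /f_part_stem slice_eval_hcC slice_evalN !mulNr; congr (- (_ * _)).
(* The product by the constant is a slice product over all of H, computed with the stem [hcC (c i)]
   of the constant. *)
rewrite slice_pt_setT (slice_prodE (F := cst (hcC (c i))) (G := trunc_stem lam i) conj_setT) //.
- split; first by rewrite shadow_circularization //; exact: stemC.
  by move=> t _; rewrite slice_of_eval /slice_eval /= mulr0 addr0.
- split; first by rewrite shadow_circularization //; exact: stem_trunc.
  by move=> t _; exact: exp_truncE.
by rewrite -slice_pt_setT.
Qed.

Lemma stem_poly D d (c : 'I_d.+1 -> quat R) : stem_function D (poly_stem c).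
Proof.
by apply: stem_sum => n; apply: stemM; [exact: stem_hcZX|exact: stemC].
Qed.

Lemma stem_f_star D lam d (c : 'I_d.+1 -> quat R) : stem_function D (f_star_stem lam c).
Proof. by apply: stem_sum => n; exact: stem_f_part. Qed.

Lemma holo_f_star D lam d (c : 'I_d.+1 -> quat R) : open D -> lam != 0 ->
  holo D (f_star_stem lam c) (fun z => f_star_stem lam c z * hcC lam + poly_stem c z).
Proof.
move=> oD lam0.
have := holo_sum (fun n : 'I_d.+1 => @holo_f_part D lam (c n) n oD lam0).
apply: holo_eq_deriv => // z Dz.
by rewrite big_split /= -mulr_suml.
Qed.

(** * Stems with zero derivative *)

Lemma is_derive_line1 G (a b : R) v :
  is_derive (a, b) (1 : R, 0 : R) G v -> is_derive a (1 : R) (fun t => G (t, b)) v.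
Proof.
move=> /is_deriveP cG; apply/is_deriveP; apply: cvg_trans cG; apply: near_eq_cvg.
apply: nearW => h /=; congr (_ *: (G _ - _)).
by congr (_, _); rewrite /= scaler0 add0r.
Qed.

Lemma is_derive_line2 G (a b : R) v :
  is_derive (a, b) (0 : R, 1 : R) G v -> is_derive b (1 : R) (fun t => G (a, t)) v.
Proof.
move=> /is_deriveP cG; apply/is_deriveP; apply: cvg_trans cG; apply: near_eq_cvg.
apply: nearW => h /=; congr (_ *: (G _ - _)).
by congr (_, _); rewrite /= scaler0 add0r.
Qed.

(** Two points are joined through the corner (a', b) by axis-parallel segments, which stay inside a
    product of intervals. *)
Lemma holo0_rect D G (I1 I2 : set R) z z' : holo D G (cst 0) ->
  is_interval I1 -> is_interval I2 -> I1 `*` I2 `<=` D ->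
  (I1 `*` I2) z -> (I1 `*` I2) z' -> G z = G z'.
Proof.
move=> hG i1 i2 sD.
have h1 a a' b : I1 a -> I1 a' -> I2 b -> G (a, b) = G (a', b).
  wlog : a a' / a <= a' => [W|aa'] Ia Ia' Ib.
    by case: (leP a a') => [/W|/ltW /W h]; [exact|rewrite h].
  apply: (is_derive_zero_eq (f := fun t => G (t, b)) aa') => t ta; apply: is_derive_line1.
  by have [] := hG (t, b) (sD (t, b) (conj (i1 _ _ Ia Ia' _ ta) Ib)).
have h2 a b b' : I1 a -> I2 b -> I2 b' -> G (a, b) = G (a, b').
  wlog : b b' / b <= b' => [W|bb'] Ia Ib Ib'.
    by case: (leP b b') => [/W|/ltW /W h]; [exact|rewrite h].
  apply: (is_derive_zero_eq (f := fun t => G (a, t)) bb') => t tb; apply: is_derive_line2.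
  have [_ + _] := hG (a, t) (sD (a, t) (conj Ia (i2 _ _ Ib Ib' _ tb))).
  by rewrite mulr0.
by case: z z' => a b [a' b'] [/= Ia Ib] [/= Ia' Ib']; rewrite (h1 a a') // (h2 a' b b').
Qed.

(** Balls of the plane are squares, hence products of intervals, so G is locally constant. This
    supplies the continuity required by [holoM]. *)
Lemma holo0_contin D G : open D -> holo D G (cst 0) -> contin D G.
Proof.
move=> oD hG z Dz.
have /nbhs_ballP [e /= e0 be] := open_nbhs_nbhs (conj oD Dz).
have ib (a : R) : is_interval (ball a e).
  move=> s t; rewrite /ball /= !ltr_distlC => /andP[s1 s2] /andP[t1 t2] r /andP[sr rt].
  by rewrite ltr_distlC (lt_le_trans s1 sr) (le_lt_trans rt t2).
have Gz : \forall t \near z, G t = G z.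
  apply/nbhs_ballP; exists e => //= t zt.
  apply: (holo0_rect hG (ib z.1) (ib z.2)) => //.
  by split; exact: ballxx.
have : G t @[t --> z] --> G z by exact: cvg_near_cst Gz.
by [].
Qed.

End Solutions.

(** * Domains *)

Section Domains.
Context {R : realType}.
Implicit Types (p q J x lam : quat R) (v u : hc R) (z : R * R) (D : set (R * R))
  (F G K : R * R -> hc R) (f g : quat R -> quat R).

(** A star-shaped set is a union of segments through its centre. *)
Lemma star_connected (V : normedModType R) (A : set V) (a : V) : A a ->
  (forall b (t : R), A b -> 0 <= t <= 1 -> A (a + t *: (b - a))) -> connected A.
Proof.
move=> Aa sA.
have -> : A = \bigcup_(b in A) ((fun t : R => a + t *: (b - a)) @` `[0, 1]).
  apply/seteqP; split=> [b Ab|c [b Ab [t /=]]].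
    by exists b => //; exists 1; rewrite /= ?in_itv /= ?ler01 ?lexx // scale1r addrC subrK.
  by rewrite in_itv /= => t01 <-; exact: sA.
apply: bigcup_connected.
  exists a => b Ab; exists 0; first by rewrite /= in_itv /= lexx ler01.
  by rewrite scale0r addr0.
move=> b Ab; apply: connected_continuous_connected; first exact: segment_connected.
apply: continuous_subspaceT => t.
by apply: cvgD; [exact: cvg_cst|apply: cvgZr_tmp; exact: cvg_id].
Qed.

Lemma connected_quat : connected [set: quat R].
Proof. exact: (star_connected (a := 0)). Qed.

Lemma real_axisP q : real_axis q <-> [/\ qi q = 0, qj q = 0 & qk q = 0].
Proof.
split; first by move=> [a _ <-]; rewrite /= mulr0.
move=> [i0 j0 k0]; exists (qre q) => //.
by apply: quatP; split; rewrite /= ?mulr1 ?mulr0.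
Qed.

(* The two pieces are star-shaped about i and about j. *)
Lemma connected_nonreal : connected (~` @real_axis R).
Proof.
(* Each piece is H minus a closed half-plane bounded by the real axis; the two removed half-planes
   meet exactly in that axis. *)
pose A := [set q : quat R | ~ [/\ qi q <= 0, qj q = 0 & qk q = 0]].
pose B := [set q : quat R | ~ [/\ qj q <= 0, qi q = 0 & qk q = 0]].
have -> : ~` @real_axis R = A `|` B.
  apply/seteqP; split=> q.
    move=> nq; apply: contrapT => /not_orP[/contrapT[_ j0 k0] /contrapT[_ i0 _]].
    by apply: nq; apply/real_axisP.
  by move=> h /real_axisP[i0 j0 k0]; case: h; apply; split=> //; rewrite ?i0 ?j0.
apply: connectedU.
- by exists (Quat 0 0 0 1); split=> -[_ _ /= /eqP]; rewrite oner_eq0.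
- apply: (star_connected (a := Quat 0 1 0 0)).
    by move=> [] /=; rewrite ler10.
  move=> b t Ab /andP[t0 t1] [] /=; rewrite !oppr0 !addr0 !add0r => h1 /eqP + /eqP.
  rewrite !mulf_eq0; have [t00|tn0] := eqVneq t 0; first by move: h1; rewrite t00; lra.
  rewrite /= => /eqP j0 /eqP k0; apply: Ab; split=> //.
  have {}t0 : 0 < t by rewrite lt_def tn0.
  by rewrite leNgt; apply/negP => i0; nra.
- apply: (star_connected (a := Quat 0 0 1 0)).
    by move=> [] /=; rewrite ler10.
  move=> b t Ab /andP[t0 t1] [] /=; rewrite !oppr0 !addr0 !add0r => h1 /eqP + /eqP.
  rewrite !mulf_eq0; have [t00|tn0] := eqVneq t 0; first by move: h1; rewrite t00; lra.
  rewrite /= => /eqP j0 /eqP k0; apply: Ab; split=> //.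
  have {}t0 : 0 < t by rewrite lt_def tn0.
  by rewrite leNgt; apply/negP => i0; nra.
Qed.

(** Some imaginary coordinate of q is nonzero; its modulus is a suitable radius, as coordinates are
    bounded by the norm and this one vanishes on real numbers. *)
Lemma open_nonreal : open (~` @real_axis R).
Proof.
rewrite openE => q nq.
have [k kq kR] : exists2 k, qcoord k q != 0 & forall a : R, qcoord k (a%:A) = 0.
  have [i0|i0] := eqVneq (qi q) 0; last first.
    by exists (inord 1); rewrite /qcoord inordK //= => a; rewrite mulr0.
  have [j0|j0] := eqVneq (qj q) 0; last first.
    by exists (inord 2); rewrite /qcoord inordK //= => a; rewrite mulr0.
  have [k0|k0] := eqVneq (qk q) 0; last first.
    by exists (inord 3); rewrite /qcoord inordK //= => a; rewrite mulr0.
  by case: nq; apply/real_axisP.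
apply/nbhs_ballP; exists `|qcoord k q|; first by rewrite /= normr_gt0.
move=> _ /[swap] -[a _ <-]; rewrite -ball_normE /= => h.
have := le_qcoord k (q - a%:A).
by rewrite (lin_scale_sub (@qcoord_linear _ k)) kR subr0 leNgt h.
Qed.

Definition nonreal : set (R * R) := [set z | z.2 != 0].

Lemma open_nonreal_shadow : open nonreal.
Proof.
rewrite (_ : nonreal = snd @^-1` [set x | x != 0]) //.
apply: open_comp; last exact: open_neq.
by move=> z _; exact: cvg_snd.
Qed.

Lemma conj_nonreal : conj_invariant nonreal.
Proof. by move=> z; rewrite /nonreal /= oppr_eq0. Qed.

Lemma nonreal_circ : ~` @real_axis R = circularization nonreal.
Proof.
apply/seteqP; split=> x.
  move=> nx; have [J SJ e] := slice_pt_unit x; exists (slice_pt x), J; split=> //.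
  rewrite /nonreal /=; apply/eqP => n0; apply: nx.
  by rewrite (imag_norm_eq0 n0); exists (qre x).
move=> [z [J [zn SJ ->]]] /real_axisP [].
have [_ -> -> ->] := slice_coordE z SJ; have /imag_unitsP[_ nJ] := SJ.
move=> /eqP; rewrite mulf_eq0 (negbTE zn) /= => /eqP i0.
move=> /eqP; rewrite mulf_eq0 (negbTE zn) /= => /eqP j0.
move=> /eqP; rewrite mulf_eq0 (negbTE zn) /= => /eqP k0.
by move: nJ => /eqP; rewrite i0 j0 k0 !expr0n !addr0 eq_sym oner_eq0.
Qed.

Lemma slice_domain_quat : slice_domain [set: quat R].
Proof.
split; last by exists 0; split=> //; exists 0 => //; rewrite scale0r.
split; last by split; [exact: openT|exact: connected_quat].
by exists setT; split; [exact: openT| |exact: slice_pt_setT].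
Qed.

Lemma product_domain_nonreal : product_domain (~` @real_axis R).
Proof.
split; last by rewrite setICl.
split; last by split; [exact: open_nonreal|exact: connected_nonreal].
by exists nonreal; split; [exact: open_nonreal_shadow|exact: conj_nonreal|exact: nonreal_circ].
Qed.

(* With (E1, E2) the stem of exp_lambda at z, the vanishing reads
   q E1 + J q E2 = 0 for q the value of v in C_J; as E1 and E2 commute, this
   gives q (E1^2 + E2^2) = 0, and E1^2 + E2^2 = E conj(E) is invertible. *)
Lemma slice_eval_exp_inj lam z J v : imag_units J ->
  slice_eval J (v * exp_stem lam z) = 0 -> slice_eval J v = 0.
Proof.
move=> SJ; set E := exp_stem lam z; set q := slice_eval J v.
have JJ p : J * (J * p) = - p by rewrite mulrA -expr2 SJ mulN1r.
have -> : slice_eval J (v * E) = q * E.1 + J * (q * E.2).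
  rewrite -hc_mulE /q /slice_eval /hc_mul /= !mulrDl !mulrDr -!mulrA JJ.
  by rewrite [X in _ + X = _]addrC addrACA; congr (_ + _); rewrite addrC.
move=> qE.
(* E and its conjugate are exponentials of z lambda and conj(z) lambda, which commute. *)
have cE : GRing.comm E (hc_conj E).
  rewrite (_ : hc_conj E = exp_stem lam (cconj z)); last by rewrite (@stem_exp _ setT).
  rewrite /E /exp_stem; apply/commr_sym/hcexp_comm/commr_sym/hcexp_comm.
  apply: commrM; first exact: hcZ_comm.
  by apply/commr_sym/commrM => //; exact: hcZ_comm.
(* The second component of this commutation says that E.2 E.1 - E.1 E.2 equals its own negative. *)
have E21 : E.2 * E.1 = E.1 * E.2.
  move: cE => /(congr1 snd); rewrite -!hc_mulE /hc_conj /hc_mul /= !mulrN !mulNr => e.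
  pose x := E.2 * E.1 - E.1 * E.2.
  have xN : x = - x by rewrite opprB /x -e addrC.
  have : 2%:R *: x = 0 by rewrite scaler_nat mulr2n {1}xN addNr.
  by move/eqP; rewrite scaler_eq0 pnatr_eq0 /= subr_eq0 => /eqP.
pose N := E.1 * E.1 + E.2 * E.2.
have qN : q * N = 0.
  rewrite /N mulrDr !mulrA.
  have -> : q * E.1 = - (J * (q * E.2)) by apply/eqP; rewrite -addr_eq0 qE.
  rewrite mulNr -!mulrA E21.
  rewrite (mulrA q E.1) (_ : q * E.1 = - (J * (q * E.2))); last by apply/eqP; rewrite -addr_eq0 qE.
  by rewrite mulNr mulrN opprK -mulrA JJ -mulrA addNr.
have NE : E * hc_conj E = hcC N.
  rewrite -hc_mulE /hc_conj /hc_mul /= !mulrN opprK; congr (_, _).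
  by rewrite E21 addNr.
(* With E' = exp(-z lambda), the inverse of E conj(E) is E' conj(E'); its first component inverts N
   among the quaternions. *)
have inv : hcC N * (exp_stem (- lam) z * hc_conj (exp_stem (- lam) z)) = 1.
  rewrite -NE cE -mulrA (mulrA E) exp_stemK mul1r -hc_conjM exp_stemK.
  by rewrite /hc_conj /= oppr0.
have := congr1 fst inv; rewrite -hc_mulE /hc_mul /= mul0r subr0 => N1.
by rewrite -[q]mulr1 -[1]N1 mulrA qN mul0r.
Qed.

End Domains.

(** * Solutions *)

Section General.
Context {R : realType}.
Implicit Types (p q J x lam : quat R) (v u : hc R) (z : R * R) (D : set (R * R))
  (F G K : R * R -> hc R) (f g : quat R -> quat R).

(** * The homogeneous equation *)

Lemma holo_diff_solution D F G H lam : open D ->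
  holo D F (fun z => F z * hcC lam + H z) ->
  holo D G (fun z => G z * hcC lam + H z) ->
  holo D (fun z => F z - G z) (fun z => (F z - G z) * hcC lam).
Proof.
move=> oD hF hG; apply: (holo_eq_deriv oD _ (holoD hF (holoN hG))) => z _.
by rewrite mulrBl opprD addrACA subrr addr0.
Qed.

(** The product rule gives K lambda exp(-z lambda) - K exp(-z lambda) lambda, and lambda commutes
    with the exponential. *)
Lemma holo_eigen_const D K lam : open D -> lam != 0 ->
  holo D K (fun z => K z * hcC lam) ->
  holo D (fun z => K z * exp_stem (- lam) z) (cst 0).
Proof.
move=> oD lam0 hK.
(* [class_C1] asks for continuous partial derivatives only; here continuity of
   K itself is read off from K = K' lambda^-1. *)
have cK : contin D K.
  move=> z Dz; have [_ _ c] := hK z Dz.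
  have KE t : K t * hcC lam * hcC lam^-1 = K t.
    by rewrite -mulrA -hcCM mulrV ?mulr1 //; exact: lam0.
  have : K t * hcC lam * hcC lam^-1 @[t --> z] --> K z * hcC lam * hcC lam^-1.
    by apply: hc_cvgM => //; exact: cvg_cst.
  by rewrite KE; under eq_fun do rewrite KE.
apply: (holo_eq_deriv oD _ (holoM cK (@contin_exp _ (- lam) D) hK (@holo_exp _ (- lam) D))).
move=> z _ /=; rewrite -mulrA -mulrDr hcCN mulrN.
have C : GRing.comm (hcC lam) (exp_stem (- lam) z) by apply: exp_stem_comm; apply: commrN.
by rewrite C subrr mulr0.
Qed.

Lemma stem_real D F (y : R) : stem_function D F -> D (y, 0) -> (F (y, 0)).2 = 0.
Proof.
move=> sF Dy; have := sF _ Dy; rewrite /cconj /= oppr0 => /(congr1 snd) /= e.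
have : 2%:R *: (F (y, 0)).2 = 0 by rewrite scaler_nat mulr2n {1}e addNr.
by move/eqP; rewrite scaler_eq0 pnatr_eq0 /= => /eqP.
Qed.

Lemma slice_pt_real (y : R) : slice_pt (y%:A : quat R) = (y, 0).
Proof.
by rewrite /slice_pt /imag_norm /= mulr1 !mulr0 expr0n !addr0 sqrtr0.
Qed.

Lemma imag_dir_real (y : R) : imag_dir (y%:A : quat R) = 0.
Proof.
have n0 : imag_norm (y%:A : quat R) = 0 := congr1 snd (slice_pt_real y).
by rewrite /imag_dir n0 invr0 scale0r.
Qed.

Lemma induces_exp D lam : conj_invariant D ->
  induces (circularization D) (exp_stem lam) (exp_slice lam).
Proof.
move=> cD; split; last by move=> x _; exact: exp_sliceE.
by rewrite shadow_circularization //; exact: stem_exp.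
Qed.

(** * The equation with a fixed polynomial right-hand side *)

Section Solution.
Variables (lam : quat R) (d : nat) (c : 'I_d.+1 -> quat R).
Hypothesis lam_neq0 : lam != 0.
Let h := right_poly c.
Let fs := f_star lam c.

Lemma solutionP D f : open D -> conj_invariant D ->
  D_solution (circularization D) lam h f <->
  exists F, induces (circularization D) F f /\
    holo D F (fun z => F z * hcC lam + poly_stem c z).
Proof.
by move=> oD cD; apply: D_solutionP => //; [exact: stem_poly|exact: right_polyE].
Qed.

(** Variation of constants: G is the difference of the stems of f and of the particular solution,
    multiplied by exp(-z lambda). *)
Lemma solution_stem D f : open D -> conj_invariant D ->
  D_solution (circularization D) lam h f ->
  exists G, [/\ stem_function D G, holo D G (cst 0) &
    forall x, circularization D x -> f x = fs x + slice_of (fun z => G z * exp_stem lam z) x].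
Proof.
move=> oD cD /(solutionP _ oD cD) [F [[sF fF] hF]]; rewrite shadow_circularization // in sF.
exists (fun z => (F z - f_star_stem lam c z) * exp_stem (- lam) z); split.
- apply: stemM; last exact: stem_exp.
  by apply: stemD => //; apply: stemN; exact: stem_f_star.
- apply: holo_eigen_const => //.
  exact: (holo_diff_solution oD hF (@holo_f_star _ D lam d c oD lam_neq0)).
- move=> x Ox; rewrite fF // /fs f_starE !slice_of_eval -slice_evalD.
  by rewrite -mulrA exp_stemVK mulr1 addrC subrK.
Qed.

Lemma general_solution D f : open D -> conj_invariant D ->
  D_solution (circularization D) lam h f <->
  exists2 g, slice_constant (circularization D) g &
    forall x, circularization D x ->
      f x = fs x + slice_prod (circularization D) g (exp_slice lam) x.
Proof.
move=> oD cD; split.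
  move=> /(solution_stem oD cD) [G [sG hG fG]].
  have iG := induces_slice_of cD sG; exists (slice_of G).
    by apply/slice_constantP => //; exists G.
  by move=> x Ox; rewrite (slice_prodE cD iG (induces_exp lam cD) Ox) fG.
move=> [g /(slice_constantP _ oD cD) [G [iG hG]] fg].
have [sG _] := iG; rewrite shadow_circularization // in sG.
apply/solutionP => //; exists (fun z => f_star_stem lam c z + G z * exp_stem lam z); split.
  split.
    rewrite shadow_circularization //; apply: stemD; first exact: stem_f_star.
    by apply: stemM => //; exact: stem_exp.
  move=> x Ox; rewrite fg // (slice_prodE cD iG (induces_exp lam cD) Ox).
  by rewrite /fs f_starE !slice_of_eval slice_evalD.
have hE := holoM (holo0_contin oD hG) (@contin_exp _ lam D) hG (@holo_exp _ lam D).
apply: (holo_eq_deriv oD _ (holoD (@holo_f_star _ D lam d c oD lam_neq0) hE)) => z _.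
by rewrite /= mul0r add0r mulrDl mulrA addrAC.
Qed.

Lemma entire_solution (y : R) f : D_solution setT lam h f ->
  let a := (f y%:A - fs y%:A) * exp_slice (- lam) y%:A in
  forall x, f x = fs x + slice_prod setT (cst a) (exp_slice lam) x.
Proof.
have oT : open [set: R * R] by exact: openT.
have cT := @conj_setT R.
rewrite slice_pt_setT => /(solution_stem oT cT) [G [sG hG fG]] a x.
have Tx q : circularization [set: R * R] q by rewrite -slice_pt_setT.
have iT : is_interval [set: R] by [].
have Gc z : G z = G (y, 0) by apply: (holo0_rect hG iT iT).
(* At a real point second components of stems vanish, so f(y) - fs(y) is the first component of G
   exp(y lambda), and multiplying by exp(-y lambda) recovers G. *)
have aE : G (y, 0) = hcC a.
  have G2 : (G (y, 0)).2 = 0 := stem_real sG I.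
  have E2 : (exp_stem (- lam) (y, 0)).2 = 0 := stem_real (@stem_exp _ setT (- lam)) I.
  rewrite [LHS]surjective_pairing G2; congr (_, _).
  rewrite /a fG // addrAC subrr add0r exp_sliceE !slice_of_eval imag_dir_real slice_pt_real.
  rewrite /slice_eval !mul0r !addr0 -[in LHS](mulr1 (G (y, 0))) -(exp_stemK lam (y, 0)) mulrA.
  by rewrite -hc_mulE /hc_mul /= E2 mulr0 subr0.
have ia : induces (circularization [set: R * R]) (cst (hcC a)) (cst a).
  split; first by rewrite shadow_circularization //; exact: stemC.
  by move=> t _; rewrite slice_of_eval /slice_eval /= mulr0 addr0.
rewrite (slice_prodE cT ia (induces_exp lam cT) (Tx x)) fG //.
by rewrite !slice_of_eval Gc aE.
Qed.

(** The difference of the two stems G is a constant (a, b) on the upper half-plane. The two values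
    give a + J1 b = 0 and a + J2 b = 0, hence a = b = 0. *)
Lemma nonreal_solution_unique (z1 z2 : R * R) J1 J2 f1 f2 :
  0 < z1.2 -> 0 < z2.2 -> imag_units J1 -> imag_units J2 -> J1 != J2 ->
  D_solution (~` @real_axis R) lam h f1 -> D_solution (~` @real_axis R) lam h f2 ->
  f1 (z1.1%:A + z1.2 *: J1) = f2 (z1.1%:A + z1.2 *: J1) ->
  f1 (z2.1%:A + z2.2 *: J2) = f2 (z2.1%:A + z2.2 *: J2) ->
  forall x, (~` @real_axis R) x -> f1 x = f2 x.
Proof.
move=> b1 b2 S1 S2 J12; rewrite nonreal_circ.
have oD := @open_nonreal_shadow R; have cD := @conj_nonreal R.
move=> /(solution_stem oD cD) [G1 [sG1 hG1 fG1]] /(solution_stem oD cD) [G2 [sG2 hG2 fG2]].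
pose G z := G1 z - G2 z.
have hG : holo nonreal G (cst 0).
  apply: (holo_eq_deriv oD _ (holoD hG1 (holoN hG2))) => z _ /=.
  by rewrite subrr.
have iP : is_interval [set t : R | 0 < t].
  by move=> s t /= s0 t0 r /andP[sr _]; exact: lt_le_trans sr.
have iT : is_interval [set: R] by [].
have sub : [set: R] `*` [set t : R | 0 < t] `<=` nonreal.
  by move=> z [_ /= z0]; rewrite /nonreal /= gt_eqF.
have Gc z : 0 < z.2 -> G z = G z1 by move=> z0; apply: (holo0_rect hG iT iP sub).
(* Equality at one point of the slice of J makes G exp(z lambda) vanish there, and
   [slice_eval_exp_inj] removes the exponential. *)
have key z J : 0 < z.2 -> imag_units J ->
    f1 (z.1%:A + z.2 *: J) = f2 (z.1%:A + z.2 *: J) -> slice_eval J (G z1) = 0.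
  move=> z0 SJ; have Dz : nonreal z by rewrite /nonreal /= gt_eqF.
  have Oz := circ_slice Dz SJ; rewrite fG1 // fG2 // => /addrI.
  rewrite (slice_ofE cD (stemM sG1 (@stem_exp _ _ lam)) Dz SJ).
  rewrite (slice_ofE cD (stemM sG2 (@stem_exp _ _ lam)) Dz SJ) => e.
  apply: (@slice_eval_exp_inj _ lam z J) => //.
  rewrite -(Gc z z0) /G mulrBl slice_evalD slice_evalN.
  by apply/eqP; rewrite subr_eq0; apply/eqP.
move=> /(key _ _ b1 S1) e1 /(key _ _ b2 S2) e2 x Ox.
have G12 : (G z1).2 = 0.
  have u : J1 - J2 \is a GRing.unit by rewrite -subr_eq0 in J12.
  apply: (mulrI u); rewrite mulr0 mulrBl.
  have := congr2 (fun a b => a - b) e1 e2.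
  by rewrite /slice_eval opprD addrACA subrr add0r subrr.
have G11 : (G z1).1 = 0 by move: e1; rewrite /slice_eval G12 mulr0 addr0.
(* [slice_pt] represents every nonreal x by a point of the upper half-plane, so knowing G there
   suffices. *)
have Dx : 0 < (slice_pt x).2.
  have := slice_pt_circ cD Ox; rewrite /nonreal /= => n0.
  by rewrite lt_def n0 imag_norm_ge0.
have Gx : G1 (slice_pt x) = G2 (slice_pt x).
  apply/eqP; rewrite -subr_eq0; apply/eqP; rewrite -/(G _) (Gc _ Dx).
  by rewrite [LHS]surjective_pairing G11 G12.
by rewrite fG1 // fG2 // !slice_of_eval Gx.
Qed.

End Solution.
End General.

(** In the last clause the two points lie on different half-slices: beta is positive and J1 differs
    from J2. Two points of the same half-slice would only give one equation a + J b = 0, which has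
    nonzero solutions. *)
Theorem proposition6 (R : realType) (lam : quat R) (d : nat)
    (c : 'I_d.+1 -> quat R) (lam_neq0 : lam != 0) :
  let h := right_poly c in
  let fs := f_star lam c in
  [/\ D_solution setT lam h fs,
      (forall Omega : set (quat R), axially_symmetric_domain Omega ->
        forall f : quat R -> quat R,
          D_solution Omega lam h f <->
          exists2 g : quat R -> quat R, slice_constant Omega g &
            forall x, Omega x ->
              f x = fs x + slice_prod Omega g (exp_slice lam) x),
      slice_domain [set: quat R] /\
      (forall y : R,
        (forall f1 f2 : quat R -> quat R,
          D_solution setT lam h f1 -> D_solution setT lam h f2 ->
          f1 y%:A = f2 y%:A -> forall x, f1 x = f2 x) /\
        (forall f : quat R -> quat R, D_solution setT lam h f ->
          let a := (f y%:A - fs y%:A) * exp_slice (- lam) y%:A in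
          forall x, f x = fs x + slice_prod setT (cst a) (exp_slice lam) x)) &
      product_domain (~` @real_axis R) /\
      (forall (al1 be1 al2 be2 : R) (J1 J2 : quat R),
        0 < be1 -> 0 < be2 -> imag_units J1 -> imag_units J2 -> J1 != J2 ->
        forall f1 f2 : quat R -> quat R,
          D_solution (~` @real_axis R) lam h f1 ->
          D_solution (~` @real_axis R) lam h f2 ->
          f1 (al1%:A + be1 *: J1) = f2 (al1%:A + be1 *: J1) ->
          f1 (al2%:A + be2 *: J2) = f2 (al2%:A + be2 *: J2) ->
          forall x, (~` @real_axis R) x -> f1 x = f2 x)].
Proof.
move=> h fs; have oT : open [set: R * R] by exact: openT.
have cT := @conj_setT R.
split.
- rewrite slice_pt_setT; apply/(solutionP lam c fs oT cT).
  exists (f_star_stem lam c); split; last exact: holo_f_star.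
  split; first by rewrite shadow_circularization //; exact: stem_f_star.
  by move=> x _; exact: f_starE.
- move=> Omega [[D [oD cD ->]] _] f; exact: general_solution.
- split; first exact: slice_domain_quat.
  move=> y; split; last by move=> f sf; exact: entire_solution.
  move=> f1 f2 s1 s2 e x.
  by rewrite (entire_solution lam_neq0 y s1) (entire_solution lam_neq0 y s2) e.
- split; first exact: product_domain_nonreal.
  move=> al1 be1 al2 be2 J1 J2 b1 b2 S1 S2 J12 f1 f2 s1 s2.
  exact: (@nonreal_solution_unique _ lam d c lam_neq0 (al1, be1) (al2, be2) J1 J2).
Qed.
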